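(* Suppose that $R=\bigoplus_{\mathbf n\in\mathbb N_0^r}R_{\mathbf n}$ is positively graded and standard. Let $M$ be a $\mathbb Z^r$-graded $R$-module, and let $$0\to {}^*E^0(M)\xrightarrow{d^0}{}^*E^1(M)\to\cdots\to{}^*E^i(M)\xrightarrow{d^i}{}^*E^{i+1}(M)\to\cdots$$ be the minimal $*$injective resolution of $M$. For each $i\in\mathbb N_0$, let $$\theta_i:{}^*E^i(M)\xrightarrow{\ \cong\ }\bigoplus_{\alpha\in\Lambda_i}{}^*E(R/\mathfrak p_\alpha)(-\mathbf n_\alpha)$$ be a $\mathbb Z^r$-homogeneous isomorphism, where $\mathfrak p_\alpha\in{}^*\operatorname{Spec}(R)$ and $\mathbf n_\alpha\in\mathbb Z^r$ for all $\alpha\in\Lambda_i$. Let $\mathfrak p\in{}^*\operatorname{Var}(R_{\mathbf 1}R)$, let $m=\#\operatorname{dir}(\mathfrak p)$, let $\phi(\mathfrak p):\mathbb Z^r\to\mathbb Z^m$ be the associated projection, and let $T:=R_{(\mathfrak p)}/\mathfrak pR_{(\mathfrak p)}$. Let $i\in\mathbb N_0$ and let $\mathbf a\in\mathbb Z^m$. Then the cardinality of the set $\{\alpha\in\Lambda_i:\mathfrak p_\alpha=\mathfrak p\text{ and }\phi(\mathfrak p)(\mathbf n_\alpha)=\mathbf a\}$ is equal to $$\operatorname{rank}_{(T^{\phi(\mathfrak p)})_{\mathbf 0}}\Big(\big(\big({}^*\operatorname{Ext}^i_{R_{(\mathfrak p)}}(R_{(\mathfrak p)}/\mathfrak pR_{(\mathfrak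 p)},M_{(\mathfrak p)})\big)^{\phi(\mathfrak p)}\big)_{\mathbf a}\Big).$$
   Context: $r$ is a positive integer; $\mathbb N_0$ is the set of non-negative integers. $R$ is a commutative Noetherian ring graded by $\mathbb Z^r$. On $\mathbb Z^r$, $\mathbf n\le\mathbf m$ means $n_i\le m_i$ for all $i$; $\mathbf e_i$ is the $i$th unit vector, $\mathbf 1=(1,\dots,1)$. $R$ is positively graded if $R_{\mathbf n}=0$ for all $\mathbf n\not\ge\mathbf 0$; it is then standard if $R=R_{\mathbf 0}[R_{\mathbf e_1},\dots,R_{\mathbf e_r}]$. ${}^*\mathcal C(R)$ is the category of $\mathbb Z^r$-graded $R$-modules and homogeneous homomorphisms of degree $\mathbf 0$; ''$\mathbb Z^r$-homogeneous isomorphism'' means isomorphism in this category. A $*$injective module is an injective object of it; ${}^*E(M)$ is the injective envelope of $M$ in it, and ${}^*E^i(M)$ is the $i$th term of the minimal injective resolution of $M$ in it. ${}^*\operatorname{Hom}_R(M,N)$ is the direct sum over $\mathbf a\in\mathbb Z^r$ of the groups of homogeneous homomorphisms of degree $\mathbf a$, and ${}^*\operatorname{Ext}^i_R$ is its $i$th right derived functor in ${}^*\mathcal C(R)$. Shift: $(M(\mathbf a))_{\mathbf g}=M_{\mathbf a+\mathbf g}$. ${}^*\operatorname{Spec}(R)$ is the set of $\mathbb Z^r$-graded primes of $R$, and ${}^*\operatorname{Var}(\mathfrak a)=\{\mathfrak p\in{}^*\operatorname{Spec}(R):\mathfrak p\supseteq\mathfrak a\}$. For $\mathfrak p\in{}^*\operatorname{Spec}(R)$,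 the homogeneous localizations $R_{(\mathfrak p)},M_{(\mathfrak p)}$ are obtained by inverting all homogeneous elements of $R\setminus\mathfrak p$. For a group homomorphism $\phi:\mathbb Z^r\to\mathbb Z^m$ and a $\mathbb Z^r$-graded module (or ring) $M$, $M^\phi$ denotes $M$ with the $\mathbb Z^m$-grading $(M^\phi)_{\mathbf h}=\bigoplus_{\phi(\mathbf n)=\mathbf h}M_{\mathbf n}$. For $\mathfrak p\in{}^*\operatorname{Spec}(R)$, $\operatorname{dir}(\mathfrak p)=\{j\in\{1,\dots,r\}:R_{\mathbf e_j}\subseteq\mathfrak p\}$; this is non-empty if and only if $\mathfrak p\supseteq R_{\mathbf 1}$. If $\operatorname{dir}(\mathfrak p)=\{i_1<\dots<i_m\}\neq\emptyset$, then $\phi(\mathfrak p):\mathbb Z^r\to\mathbb Z^m$ is $\phi(\mathfrak p)(n_1,\dots,n_r)=(n_{i_1},\dots,n_{i_m})$. For $T=R_{(\mathfrak p)}/\mathfrak pR_{(\mathfrak p)}$ and any $\mathbb Z^r$-graded $T$-module $L$, the $\mathbb Z^m$-graded ring $T^{\phi(\mathfrak p)}$ is concentrated in degree $\mathbf 0\in\mathbb Z^m$ and each component of $L^{\phi(\mathfrak p)}$ is a free $(T^{\phi(\mathfrak p)})_{\mathbf 0}$-module, so its rank is defined. *)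

(* Defs.v *)
From HB Require Import structures.
From mathcomp Require Import all_boot all_order all_algebra.
From mathcomp Require Import generic_quotient ring_quotient.
From mathcomp Require Import boolp classical_sets functions cardinality.
From mathcomp Require Import ring.

Set Implicit Arguments.
Unset Strict Implicit.
Unset Printing Implicit Defensive.

Import Order.TTheory GRing.Theory Num.Theory.
Local Open Scope classical_set_scope.
Local Open Scope ring_scope.

Section Gradings.
Variables (G : zmodType) (V : zmodType).
Implicit Types (A P : set V) (C : G -> set V).

Definition subgroup A := A 0 /\ forall x y, A x -> A y -> A (x - y).

Definition homog C : set V := [set v | exists g, C g v].

Definition fin_sums A : set V :=
  [set x | exists2 s : seq V, (forall v, v \in s -> A v) & x = \sum_(v <- s) v].

(* P is the internal direct sum of the subgroups C g. *)
Definition grading_on P C :=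
  [/\ forall g, subgroup (C g) /\ C g `<=` P,
      P `<=` fin_sums (homog C)
    & forall (s : seq G) (f : G -> V), uniq s -> (forall g, C g (f g)) ->
        \sum_(g <- s) f g = 0 -> forall g, g \in s -> f g = 0].

Definition is_grading C := grading_on setT C.

Definition graded_sub C P := P `<=` fin_sums (P `&` homog C).

Lemma subgroup0 A : subgroup A -> A 0. Proof. by case. Qed.
Lemma subgroupB A x y : subgroup A -> A x -> A y -> A (x - y).
Proof. by case=> _; apply. Qed.
Lemma subgroupN A x : subgroup A -> A x -> A (- x).
Proof. by move=> [A0 AB] Ax; rewrite -sub0r; apply: AB. Qed.
Lemma subgroupD A x y : subgroup A -> A x -> A y -> A (x + y).
Proof. by move=> sA Ax Ay; rewrite -[y]opprK; apply: subgroupB => //; apply: subgroupN. Qed.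
Lemma subgroup_sum A (I : eqType) (s : seq I) (f : I -> V) : subgroup A ->
  (forall i, i \in s -> A (f i)) -> A (\sum_(i <- s) f i).
Proof.
move=> sA; elim: s => [|i s IH] H; first by rewrite big_nil; case: sA.
rewrite big_cons; apply: subgroupD => //; first by apply: H; rewrite mem_head.
by apply: IH => j js; apply: H; rewrite inE js orbT.
Qed.

Lemma fin_sums_sub A P : subgroup P -> A `<=` P -> fin_sums A `<=` P.
Proof. by move=> sP AP _ [s sA ->]; apply: subgroup_sum => // v /sA /AP. Qed.

Lemma fin_sums_incl A P : A `<=` P -> fin_sums A `<=` fin_sums P.
Proof. by move=> AP x [s sA ->]; exists s => // v /sA /AP. Qed.

Lemma fin_sums_id A : A `<=` fin_sums A.
Proof. by move=> x Ax; exists [:: x]; rewrite ?big_seq1 // => v; rewrite inE => /eqP ->. Qed.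

Lemma fin_sums_subgroup A : (forall v, A v -> A (- v)) -> subgroup (fin_sums A).
Proof.
move=> AN; split=> [|_ _ [s sA ->] [t tA ->]].
  by exists [::]; rewrite ?big_nil.
exists (s ++ map -%R t); last by rewrite big_cat big_map sumrN.
by move=> v; rewrite mem_cat => /orP[/sA //|/mapP[w /tA /AN Aw ->]].
Qed.

Lemma homogN C v : (forall g, subgroup (C g)) -> homog C v -> homog C (- v).
Proof. by move=> sV [g Vv]; exists g; apply: subgroupN. Qed.

Lemma fin_sums_homogE C P x : (forall g, subgroup (C g)) -> subgroup P ->
  fin_sums (P `&` homog C) x ->
  exists (s : seq G) (f : G -> V), [/\ uniq s, forall g, P (f g) /\ C g (f g),
    forall g, g \notin s -> f g = 0 & x = \sum_(g <- s) f g].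
Proof.
move=> sV sP [t tP ->]; elim: t tP => [|v t IH] tP.
  exists [::], (fun=> 0); rewrite !big_nil; split=> // g.
  by split; apply: subgroup0.
have [|s [f [us fP f0 e]]] := IH.
  by move=> w wt; apply: tP; rewrite inE wt orbT.
have [Pv [g0 Vv]] := tP v (mem_head _ _).
exists (undup (g0 :: s)), (fun g => f g + (if g == g0 then v else 0)).
split=> [|g|g|].
- exact: undup_uniq.
- have [Pf Vf] := fP g; case: eqP => [gg|_]; last by rewrite addr0.
  by split; apply: subgroupD => //; rewrite gg.
- by rewrite mem_undup inE negb_or => /andP[/negPf -> /f0 ->]; rewrite addr0.
- rewrite big_cons e big_split -big_mkcond [RHS]addrC; congr (_ + _).
    rewrite -[RHS]big_filter (perm_big [:: g0]) ?big_seq1 //.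
    apply: uniq_perm => //; first by rewrite filter_uniq ?undup_uniq.
    by move=> g; rewrite mem_filter mem_undup !inE; case: eqP.
  rewrite /= undup_id //; case: ifP => gs //.
  by rewrite big_cons f0 ?gs ?add0r.
Qed.

Lemma grading_homogE C P x : grading_on P C -> P x ->
  exists (s : seq G) (f : G -> V), [/\ uniq s, forall g, C g (f g),
    forall g, g \notin s -> f g = 0 & x = \sum_(g <- s) f g].
Proof.
move=> [sV gV _] /gV Px.
have [|||s [f [us fP f0 e]]] := @fin_sums_homogE C setT x.
- by move=> g; have [] := sV g.
- by split.
- by apply: fin_sums_incl Px => v Hv; split.
by exists s, f; split=> // g; have [] := fP g.
Qed.

(* The homogeneous components of an element of a graded subgroup lie in it. *)
Lemma graded_sub_sum C Q P : grading_on Q C -> subgroup P -> graded_sub C P ->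
  forall (s : seq G) (f : G -> V), uniq s -> (forall g, C g (f g)) ->
    P (\sum_(g <- s) f g) -> forall g, g \in s -> P (f g).
Proof.
move=> [sV _ iV] sP gP s f us fV /gP.
have sV' g : subgroup (C g) by have [] := sV g.
move=> /fin_sums_homogE -/(_ sV' sP)[t [h [ut hP h0 e]]].
pose u := undup (s ++ t).
pose f' g := if g \in s then f g else 0.
have f'V g : C g (f' g).
  by rewrite /f'; case: ifP => // _; apply: subgroup0.
have e1 : \sum_(g <- s) f g = \sum_(g <- u) f' g.
  rewrite /f' -big_mkcond -[RHS]big_filter; apply: perm_big; apply: uniq_perm => //.
    by rewrite filter_uniq ?undup_uniq.
  by move=> g; rewrite mem_filter mem_undup mem_cat; case: (g \in s).
have e2 : \sum_(g <- t) h g = \sum_(g <- u) h g.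
  rewrite [RHS](bigID (mem t)) /= [X in _ + X]big1 ?addr0; last by move=> g /h0.
  rewrite -[RHS]big_filter; apply: perm_big; apply: uniq_perm => //.
    by rewrite filter_uniq ?undup_uniq.
  by move=> g; rewrite mem_filter mem_undup mem_cat; case: (g \in t); rewrite ?orbT ?andbF.
have := iV u (fun g => f' g - h g) (undup_uniq _).
have H g : C g (f' g - h g) by apply: subgroupB => //; have [] := hP g.
move=> /(_ H); rewrite sumrB -e1 -e2 e subrr => /(_ erefl) eq0 g gs.
have /subr0_eq : f' g - h g = 0 by apply: eq0; rewrite mem_undup mem_cat gs.
by rewrite /f' gs => ->; have [] := hP g.
Qed.

End Gradings.

Record gradedRing (G : zmodType) := GradedRing {
  gring :> comPzRingType;
  rcomp : G -> set gring;
  rcomp_grading : is_grading rcomp;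
  rcomp1 : rcomp 0 1;
  rcompM : forall g h a b, rcomp g a -> rcomp h b -> rcomp (g + h) (a * b) }.

Record gradedModule (G : zmodType) (R : gradedRing G) := GradedModule {
  gmod :> lmodType R;
  mcomp : G -> set gmod;
  mcomp_grading : is_grading mcomp;
  mcompZ : forall g h a x, rcomp g a -> mcomp h x -> mcomp (g + h) (a *: x) }.

Section Submodules.
Variables (R : comPzRingType) (V : lmodType R).
Implicit Type P : set V.

Definition is_submod P := P 0 /\ forall a x y, P x -> P y -> P (a *: x + y).

Lemma is_submod_subgroup P : is_submod P -> subgroup P.
Proof. by move=> [P0 PL]; split=> // x y Px Py; rewrite addrC -scaleN1r; apply: PL. Qed.

Lemma is_submodZ P a x : is_submod P -> P x -> P (a *: x).
Proof. by move=> [P0 PL] Px; rewrite -[_ *: _]addr0; apply: PL. Qed.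

Lemma is_submodP P : subgroup P -> (forall a x, P x -> P (a *: x)) -> is_submod P.
Proof.
by move=> sP PZ; split=> [|a x y /PZ Px Py]; [apply: subgroup0|apply: subgroupD].
Qed.

Variables (P : set V) (hP : is_submod P).

Definition submod_pred of is_submod P : V -> bool := fun x => `[< P x >].

Lemma submod_pred_closed : submod_closed (submod_pred hP : {pred V}).
Proof.
split=> [|a x y /asboolP Px /asboolP Py]; apply/asboolP; first by case: hP.
by case: hP => _; apply.
Qed.

HB.instance Definition _ :=
  GRing.isSubmodClosed.Build R V (submod_pred hP) submod_pred_closed.

Record submod := Submod { submod_val : V; submod_valP : submod_val \in submod_pred hP }.

HB.instance Definition _ := [isSub for submod_val].
HB.instance Definition _ := [Choice of submod by <:].
HB.instance Definition _ := [SubChoice_isSubLmodule of submod by <:].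

Lemma submod_val_linear : linear submod_val.
Proof. by move=> a x y; apply: (linearP (val : submod -> V)). Qed.
HB.instance Definition _ := GRing.isLinear.Build R submod V _ submod_val submod_val_linear.

Lemma submod_val_inj : injective submod_val.
Proof. exact: val_inj. Qed.

Lemma submodP (x : submod) : P (submod_val x).
Proof. exact/asboolP/submod_valP. Qed.

Definition to_submod x (Px : P x) : submod := Submod (asboolT Px).

Definition submod_zmodClosed : zmodClosed V :=
  GRing.ZmodClosed.clone V (submod_pred hP) _.

Definition quotmod : Type := Quotient.quot (submod_zmodClosed).

HB.instance Definition _ := GRing.Zmodule.on quotmod.

Definition qclass (x : V) : quotmod :=
  \pi_(Quotient.quot (submod_zmodClosed))%qT x.
Definition qrepr (x : quotmod) : V := @repr _ (Quotient.quot (submod_zmodClosed)) x.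

Lemma qreprK x : qclass (qrepr x) = x.
Proof. exact: reprK. Qed.

Lemma qclass_eq x y : qclass x = qclass y <-> P (x - y).
Proof.
split=> [/eqP|Pxy]; first by rewrite -Quotient.idealrBE => /asboolP.
by apply/eqP; rewrite -Quotient.idealrBE; apply/asboolP.
Qed.

Lemma qclassD x y : qclass (x + y) = qclass x + qclass y.
Proof. exact: Quotient.pi_add. Qed.

Lemma qclassN x : qclass (- x) = - qclass x.
Proof. exact: Quotient.pi_opp. Qed.

Lemma qclass0 x : qclass x = 0 <-> P x.
Proof.
have -> : 0 = qclass 0 by apply: (addrI (qclass 0)); rewrite -qclassD !addr0.
by rewrite qclass_eq subr0.
Qed.

Definition qscale a (x : quotmod) : quotmod := qclass (a *: qrepr x).

Lemma qscaleE a x : qscale a (qclass x) = qclass (a *: x).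
Proof.
by apply/qclass_eq; rewrite -scalerBr; apply: is_submodZ => //; apply/qclass_eq; rewrite qreprK.
Qed.

Lemma qscaleA a b x : qscale a (qscale b x) = qscale (a * b) x.
Proof. by rewrite -(qreprK x) !qscaleE scalerA. Qed.
Lemma qscale1 : left_id 1 qscale.
Proof. by move=> x; rewrite -(qreprK x) !qscaleE scale1r. Qed.
Lemma qscaleDr : right_distributive qscale +%R.
Proof.
by move=> a x y; rewrite -(qreprK x) -(qreprK y) -qclassD !qscaleE -qclassD scalerDr.
Qed.
Lemma qscaleDl x : {morph qscale^~ x : a b / a + b}.
Proof. by move=> a b; rewrite -(qreprK x) !qscaleE -qclassD scalerDl. Qed.

HB.instance Definition _ :=
  GRing.Zmodule_isLmodule.Build R quotmod qscaleA qscale1 qscaleDr qscaleDl.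

Lemma qclass_is_linear : linear qclass.
Proof. by move=> a x y; rewrite qclassD -qscaleE. Qed.

HB.instance Definition _ := GRing.isLinear.Build R V quotmod _ qclass qclass_is_linear.

End Submodules.

Section Ideals.
Variable R : comPzRingType.

Definition is_ideal (I : set R) := @is_submod R R^o I.

Definition ideal_gen (A : set R) : set R :=
  fin_sums [set z | exists a, exists2 x, A x & z = a * x].

Definition is_prime (I : set R) :=
  [/\ is_ideal I, ~ I 1 & forall a b, I (a * b) -> I a \/ I b].

Definition noetherian := forall I : set R, is_ideal I ->
  exists s : seq R, I = ideal_gen [set x | x \in s].

Variables (I : set R) (hI : is_ideal I).

Definition quotring : Type := @quotmod R R^o I hI.

HB.instance Definition _ := GRing.Zmodule.on quotring.

Definition rclass (a : R) : quotring := @qclass R R^o I hI a.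
Definition rrepr (x : quotring) : R := @qrepr R R^o I hI x.

Lemma rreprK x : rclass (rrepr x) = x. Proof. exact: qreprK. Qed.

Lemma rclass_eq a b : rclass a = rclass b <-> I (a - b).
Proof. exact: qclass_eq. Qed.

Definition rmul (x y : quotring) := rclass (rrepr x * rrepr y).

Lemma rmulE a b : rmul (rclass a) (rclass b) = rclass (a * b).
Proof.
have Ha : I (rrepr (rclass a) - a) by apply/rclass_eq; rewrite rreprK.
have Hb : I (rrepr (rclass b) - b) by apply/rclass_eq; rewrite rreprK.
apply/rclass_eq; set a' := rrepr _ in Ha *; set b' := rrepr _ in Hb *.
have -> : a' * b' - a * b = b' * (a' - a) + a * (b' - b).
  by rewrite !mulrBr (mulrC b' a') (mulrC b' a) addrA subrK.
by case: (hI) => _ IL; apply: IL => //; apply: (@is_submodZ R R^o).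
Qed.

Lemma rclassD a b : rclass (a + b) = rclass a + rclass b.
Proof. exact: qclassD. Qed.

Lemma rmulA : associative rmul.
Proof. by move=> x y z; rewrite -(rreprK x) -(rreprK y) -(rreprK z) !rmulE mulrA. Qed.
Lemma rmulC : commutative rmul.
Proof. by move=> x y; rewrite -(rreprK x) -(rreprK y) !rmulE mulrC. Qed.
Lemma rmul1 : left_id (rclass 1) rmul.
Proof. by move=> x; rewrite -(rreprK x) !rmulE mul1r. Qed.
Lemma rmulDl : left_distributive rmul +%R.
Proof.
by move=> x y z; rewrite -(rreprK x) -(rreprK y) -(rreprK z) -rclassD !rmulE -rclassD mulrDl.
Qed.

HB.instance Definition _ :=
  GRing.Zmodule_isComPzRing.Build quotring rmulA rmulC rmul1 rmulDl.

Lemma rclass_is_zmod_morphism : zmod_morphism rclass.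
Proof. by move=> a b; rewrite /rclass qclassD qclassN. Qed.
Lemma rclass_is_monoid_morphism : monoid_morphism rclass.
Proof. by split=> // a b; rewrite -rmulE. Qed.

HB.instance Definition _ := GRing.isZmodMorphism.Build R quotring rclass rclass_is_zmod_morphism.
HB.instance Definition _ :=
  GRing.isMonoidMorphism.Build R quotring rclass rclass_is_monoid_morphism.

(* A module annihilated by I, with its action of R/I. *)
Variables (V : lmodType R) (hV : forall a (x : V), I a -> a *: x = 0).

Definition annmod of (forall a (x : V), I a -> a *: x = 0) : Type := V.

HB.instance Definition _ := GRing.Zmodule.on (annmod hV).

Definition annscale (t : quotring) (x : annmod hV) : annmod hV := rrepr t *: (x : V).

Lemma annscaleE a (x : V) : annscale (rclass a) x = a *: x.
Proof.
apply/eqP; rewrite -subr_eq0 -scalerBl; apply/eqP; apply: hV.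
by apply/rclass_eq; rewrite rreprK.
Qed.

Lemma annscaleA s t x : annscale s (annscale t x) = annscale (s * t) x.
Proof.
by rewrite -(rreprK s) -(rreprK t) -rmorphM !annscaleE scalerA.
Qed.
Lemma annscale1 : left_id 1 annscale.
Proof. by move=> x; rewrite -(rmorph1 rclass) annscaleE scale1r. Qed.
Lemma annscaleDr : right_distributive annscale +%R.
Proof. by move=> s x y; apply: scalerDr. Qed.
Lemma annscaleDl x : {morph annscale^~ x : a b / a + b}.
Proof.
move=> s t; rewrite -(rreprK s) -(rreprK t) -rmorphD.
by rewrite !annscaleE; apply: scalerDl.
Qed.

HB.instance Definition _ :=
  GRing.Zmodule_isLmodule.Build quotring (annmod hV) annscaleA annscale1 annscaleDr annscaleDl.

End Ideals.

Section Localization.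
Variable R : comPzRingType.

Record multSet := MultSet {
  ms_set :> set R;
  ms1 : ms_set 1;
  msM : forall s t, ms_set s -> ms_set t -> ms_set (s * t) }.

Variable S : multSet.

Definition den := {s : R | `[< ms_set S s >]}.

Definition den_of s (Ss : ms_set S s) : den := exist _ s (asboolT Ss).
Definition dval (s : den) : R := val s.
Lemma denP (s : den) : ms_set S (dval s). Proof. exact/asboolP/(valP s). Qed.
Definition den1 : den := den_of (ms1 S).
Definition denM (s t : den) : den := den_of (msM (denP s) (denP t)).

Lemma dval1 : dval den1 = 1. Proof. by []. Qed.
Lemma dvalM s t : dval (denM s t) = dval s * dval t. Proof. by []. Qed.
Arguments dval : simpl never.

Section Module.
Variable V : lmodType R.

Definition loc_eq (x y : V * den) :=
  `[< exists2 u, ms_set S u & u *: (dval y.2 *: x.1) = u *: (dval x.2 *: y.1) >].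

Lemma loc_eq_refl : reflexive loc_eq.
Proof. by move=> x; apply/asboolP; exists 1; first exact: ms1. Qed.

Lemma loc_eq_sym : symmetric loc_eq.
Proof. by move=> x y; apply/asboolP/asboolP => -[u Su e]; exists u. Qed.

Lemma loc_eq_trans : transitive loc_eq.
Proof.
move=> y x z /asboolP[u Su e1] /asboolP[v Sv e2]; apply/asboolP.
exists (u * v * dval y.2); first by apply: msM (denP _); apply: msM.
have := congr1 (fun w => (v * dval z.2) *: w) e1.
have := congr1 (fun w => (u * dval x.2) *: w) e2.
rewrite !scalerA => e3 e4.
have -> : u * v * dval y.2 * dval z.2 = v * dval z.2 * u * dval y.2 by ring.
rewrite {}e4.
have -> : v * dval z.2 * u * dval x.2 = u * dval x.2 * v * dval z.2 by ring.
by rewrite e3; congr (_ *: _); ring.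
Qed.

Canonical loc_equiv := EquivRel loc_eq loc_eq_refl loc_eq_sym loc_eq_trans.
Canonical loc_encModRel := defaultEncModRel loc_eq.

Definition loc : Type := {eq_quot loc_eq}%qT.
HB.instance Definition _ := Choice.on loc.

(* the fraction x / s *)
Definition frac (x : V) (s : den) : loc := \pi_({eq_quot loc_eq})%qT (x, s).

Lemma frac_eq x s y t :
  frac x s = frac y t <-> exists2 u, ms_set S u & u *: (dval t *: x) = u *: (dval s *: y).
Proof.
split=> [/eqP|H]; first by rewrite eqmodE => /asboolP.
by apply/eqP; rewrite eqmodE; apply/asboolP.
Qed.

Lemma frac_eq1 x s y t : dval t *: x = dval s *: y -> frac x s = frac y t.
Proof. by move=> e; apply/frac_eq; exists 1; [exact: ms1|rewrite e]. Qed.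

Definition num_den (a : loc) : V * den := @repr _ {eq_quot loc_eq}%qT a.
Lemma num_denK a : frac (num_den a).1 (num_den a).2 = a.
Proof. by rewrite /frac -surjective_pairing; apply: reprK. Qed.

Lemma locP (Q : loc -> Prop) : (forall x s, Q (frac x s)) -> forall a, Q a.
Proof. by move=> H a; rewrite -(num_denK a). Qed.

Definition locadd (a b : loc) := let: (x, s) := num_den a in let: (y, t) := num_den b in
  frac (dval t *: x + dval s *: y) (denM s t).
Definition locopp (a : loc) := let: (x, s) := num_den a in frac (- x) s.

Lemma locaddE x s y t : locadd (frac x s) (frac y t) =
  frac (dval t *: x + dval s *: y) (denM s t).
Proof.
rewrite /locadd; have := num_denK (frac x s); have := num_denK (frac y t).
case: (num_den _) => y' t' /= /frac_eq[v Sv e2].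
case: (num_den _) => x' s' /= /frac_eq[u Su e1].
apply/frac_eq; exists (u * v); first exact: msM.
rewrite /= ?dvalM ?dval1 !scalerDr !scalerA; congr (_ + _).
  have := congr1 (fun w => (v * dval t * dval t') *: w) e1; rewrite !scalerA => e.
  have -> : u * v * (dval s * dval t) * dval t' = v * dval t * dval t' * u * dval s by ring.
  by rewrite e; congr (_ *: _); ring.
have := congr1 (fun w => (u * dval s * dval s') *: w) e2; rewrite !scalerA => e.
have -> : u * v * (dval s * dval t) * dval s' = u * dval s * dval s' * v * dval t by ring.
by rewrite e; congr (_ *: _); ring.
Qed.

Lemma locoppE x s : locopp (frac x s) = frac (- x) s.
Proof.
rewrite /locopp; have := num_denK (frac x s).
case: (num_den _) => x' s' /= /frac_eq[u Su e1].
by apply/frac_eq; exists u; rewrite // !scalerN e1.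
Qed.

Lemma locaddA : associative locadd.
Proof.
elim/locP => x s; elim/locP => y t; elim/locP => z u; rewrite !locaddE; apply: frac_eq1.
by rewrite /= ?dvalM ?dval1 !scalerDr !scalerA addrA; congr (_ *: _ + _ *: _ + _ *: _); ring.
Qed.
Lemma locaddC : commutative locadd.
Proof.
elim/locP => x s; elim/locP => y t; rewrite !locaddE; apply: frac_eq1.
by rewrite /= ?dvalM ?dval1 addrC [dval s * _]mulrC.
Qed.
Lemma locadd0 : left_id (frac 0 den1) locadd.
Proof.
by elim/locP => x s; rewrite locaddE; apply: frac_eq1; rewrite /= ?dvalM ?dval1 scaler0 add0r scale1r mul1r.
Qed.
Lemma locaddN : left_inverse (frac 0 den1) locopp locadd.
Proof.
elim/locP => x s; rewrite locoppE locaddE; apply: frac_eq1.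
by rewrite /= ?dvalM ?dval1 scale1r scaler0 scalerN addNr.
Qed.

HB.instance Definition _ := GRing.isZmodule.Build loc locaddA locaddC locadd0 locaddN.

Lemma fracD x s y t : frac x s + frac y t = frac (dval t *: x + dval s *: y) (denM s t).
Proof. exact: locaddE. Qed.
Lemma frac0 s : frac 0 s = 0.
Proof. by apply: frac_eq1; rewrite !scaler0. Qed.
Lemma fracN x s : frac (- x) s = - frac x s.
Proof. by rewrite -locoppE. Qed.
Lemma fracDl x y s : frac (x + y) s = frac x s + frac y s.
Proof. by rewrite fracD; apply: frac_eq1; rewrite /= ?dvalM ?dval1 -scalerDr !scalerA. Qed.
Lemma frac_sum (I : Type) (r : seq I) (F : I -> V) s :
  frac (\sum_(i <- r) F i) s = \sum_(i <- r) frac (F i) s.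
Proof. by elim: r => [|i r IH]; rewrite ?big_nil ?frac0 // !big_cons fracDl IH. Qed.

End Module.

Definition locring : Type := loc R^o.
HB.instance Definition _ := GRing.Zmodule.on locring.

Definition rfrac (a : R) (s : den) : locring := frac (a : R^o) s.

Lemma rlocP (Q : locring -> Prop) : (forall a s, Q (rfrac a s)) -> forall a, Q a.
Proof. by move=> H a; apply: (@locP R^o). Qed.
Lemma rfrac_eq1 a s b t : dval t * a = dval s * b -> rfrac a s = rfrac b t.
Proof. by move=> e; apply: (@frac_eq1 R^o). Qed.
Lemma rfracD a s b t : rfrac a s + rfrac b t = rfrac (dval t * a + dval s * b) (denM s t).
Proof. exact: fracD. Qed.

Section Scale.
Variable V : lmodType R.

Definition locscale (a : locring) (b : loc V) : loc V :=
  let: (x, s) := num_den a in let: (y, t) := num_den b in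
  frac ((x : R) *: y) (denM s t).

Lemma locscaleE x s y t : locscale (rfrac x s) (frac y t) = frac (x *: y) (denM s t).
Proof.
rewrite /locscale; have := num_denK (rfrac x s); have := num_denK (frac y t).
case: (num_den _) => y' t' /= /frac_eq[v Sv e2].
case: (num_den _) => x' s' /= /frac_eq[u Su e1].
apply/frac_eq; exists (u * v); first exact: msM.
have {}e1 : u * (dval s * x') = u * (dval s' * x) by [].
rewrite /= ?dvalM ?dval1 !scalerA.
have -> : u * v * (dval s * dval t) * x' = (u * (dval s * x')) * (v * dval t) by ring.
rewrite e1 -scalerA -[(v * _) *: _]scalerA e2 !scalerA.
by congr (_ *: _); ring.
Qed.
End Scale.

Definition locmul (a b : locring) : locring := locscale a b.

Lemma locmulE x s y t : locmul (rfrac x s) (rfrac y t) = rfrac (x * y) (denM s t).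
Proof. exact: locscaleE. Qed.

Lemma locmulA : associative locmul.
Proof.
elim/rlocP => x s; elim/rlocP => y t; elim/rlocP => z u.
by rewrite !locmulE; apply: rfrac_eq1; rewrite ?dvalM; ring.
Qed.
Lemma locmulC : commutative locmul.
Proof.
elim/rlocP => x s; elim/rlocP => y t.
by rewrite !locmulE; apply: rfrac_eq1; rewrite ?dvalM; ring.
Qed.
Lemma locmul1 : left_id (rfrac 1 den1) locmul.
Proof.
by elim/rlocP => x s; rewrite !locmulE; apply: rfrac_eq1; rewrite ?dvalM ?dval1; ring.
Qed.
Lemma locmulDl : left_distributive locmul +%R.
Proof.
elim/rlocP => x s; elim/rlocP => y t; elim/rlocP => z u.
by rewrite rfracD !locmulE rfracD; apply: rfrac_eq1; rewrite ?dvalM; ring.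
Qed.

HB.instance Definition _ :=
  GRing.Zmodule_isComPzRing.Build locring locmulA locmulC locmul1 locmulDl.

Section LocModule.
Variable V : lmodType R.

Lemma locscaleA a b (x : loc V) : locscale a (locscale b x) = locscale (a * b) x.
Proof.
elim/rlocP: a => a s; elim/rlocP: b => b t; elim/locP: x => x u.
rewrite [_ * _]locmulE !locscaleE; apply: frac_eq1.
by rewrite /= ?dvalM ?dval1 !scalerA; congr (_ *: _); ring.
Qed.
Lemma locscale1 : left_id 1 (@locscale V).
Proof.
elim/locP => x u; rewrite locscaleE; apply: frac_eq1.
by rewrite /= ?dvalM ?dval1 !scalerA; congr (_ *: _); ring.
Qed.
Lemma locscaleDr : right_distributive (@locscale V) +%R.
Proof.
elim/rlocP => a s; elim/locP => x t; elim/locP => y u.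
rewrite fracD !locscaleE fracD; apply: frac_eq1.
by rewrite /= ?dvalM ?dval1 !scalerDr !scalerA; congr (_ *: _ + _ *: _); ring.
Qed.
Lemma locscaleDl (x : loc V) : {morph (@locscale V)^~ x : a b / a + b}.
Proof.
elim/rlocP => a s; elim/rlocP => b t; elim/locP: x => x u.
rewrite rfracD !locscaleE fracD; apply: frac_eq1.
rewrite /= ?dvalM ?dval1 !scalerDr !scalerA -scalerDl.
by congr (_ *: _); ring.
Qed.

HB.instance Definition _ := GRing.Zmodule_isLmodule.Build locring (loc V)
  locscaleA locscale1 locscaleDr locscaleDl.

Lemma fracZ a s (x : V) t : rfrac a s *: frac x t = frac (a *: x) (denM s t).
Proof. exact: locscaleE. Qed.
End LocModule.

Lemma rfracM x s y t : rfrac x s * rfrac y t = rfrac (x * y) (denM s t).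
Proof. exact: locscaleE. Qed.

End Localization.

Section GradedModules.
Variables (G : zmodType) (R : gradedRing G).
Implicit Types M N A B : gradedModule R.

Lemma mcomp_subgroup M g : subgroup (@mcomp G R M g).
Proof. by have [H _ _] := mcomp_grading M; have [] := H g. Qed.

Lemma mcomp_indep M (s : seq G) (f : G -> M) : uniq s -> (forall g, mcomp g (f g)) ->
  \sum_(g <- s) f g = 0 -> forall g, g \in s -> f g = 0.
Proof. by have [_ _] := mcomp_grading M; apply. Qed.

Lemma mcompE M (x : M) : exists (s : seq G) (f : G -> M),
  [/\ uniq s, forall g, mcomp g (f g), forall g, g \notin s -> f g = 0
    & x = \sum_(g <- s) f g].
Proof. exact: (grading_homogE (mcomp_grading M)). Qed.

Section Sub.
Variables (V : lmodType R) (P : set V) (hP : is_submod P) (C : G -> set V).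
Hypothesis hC : grading_on P C.
Hypothesis hCZ : forall g h a x, rcomp g a -> C h x -> C (g + h) (a *: x).

Definition gsub_comp g : set (submod hP) := [set x | C g (submod_val x)].

Lemma gsub_grading : is_grading gsub_comp.
Proof.
have [sC gC iC] := hC; split=> [g|x _|s f us fC e].
- have [CB CP] := sC g; split=> //; split=> [|x y]; rewrite /gsub_comp /mkset.
    by rewrite (raddf0 (@submod_val R V P hP)); apply: subgroup0.
  by rewrite (raddfB (@submod_val R V P hP)); apply: subgroupB.
- have [s [f [us fC f0 e]]] := grading_homogE hC (submodP x).
  have fP g : P (f g) by have [_] := sC g; apply.
  exists [seq to_submod hP (fP g) | g <- s].
    by move=> v /mapP[g gs ->]; exists g; apply: fC.
  apply: submod_val_inj; rewrite big_map (raddf_sum (@submod_val R V P hP)) /=.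
  exact: e.
- move=> g gs; apply: submod_val_inj; rewrite (raddf0 (@submod_val R V P hP)).
  apply: (iC s (fun g => submod_val (f g))) => //.
  by rewrite -(raddf_sum (@submod_val R V P hP)) e raddf0.
Qed.

Lemma gsub_compZ g h a (x : submod hP) :
  rcomp g a -> gsub_comp h x -> gsub_comp (g + h) (a *: x).
Proof.
by move=> ga hx; rewrite /gsub_comp /mkset linearZZ; apply: hCZ.
Qed.

Definition gsub : gradedModule R := GradedModule gsub_grading gsub_compZ.
End Sub.

Section Quotient.
Variables (M : gradedModule R) (N : set M).
Hypotheses (hN : is_submod N) (gN : graded_sub (@mcomp G R M) N).

Definition gquot_comp g : set (quotmod hN) := [set qclass hN x | x in @mcomp G R M g].

Lemma gquot_grading : is_grading gquot_comp.
Proof.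
split=> [g|x _|s f us fC e].
- split=> //; split=> [|_ _ [x Mx <-] [y My <-]].
    by exists 0; [exact: (subgroup0 (mcomp_subgroup _ _))|rewrite raddf0].
  by exists (x - y); [exact: (subgroupB (mcomp_subgroup _ _))|rewrite raddfB].
- have [s [f [us fC f0 e]]] := mcompE (qrepr x).
  exists [seq qclass hN (f g) | g <- s].
    by move=> v /mapP[g gs ->]; exists g; exists (f g).
  by rewrite big_map -raddf_sum -e /= qreprK.
- have /choice[h hP] : forall g, exists x, mcomp g x /\ qclass hN x = f g.
    by move=> g; have [x] := fC g; exists x.
  move=> g gs; have [_ <-] := hP g; apply/qclass0.
  apply: (graded_sub_sum (mcomp_grading M) (is_submod_subgroup hN) gN us) gs => [k|].
    by have [] := hP k.
  apply/(qclass0 hN); rewrite raddf_sum /= -[RHS]e.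
  by apply: eq_bigr => k _; have [] := hP k.
Qed.

Lemma gquot_compZ g h a (x : quotmod hN) :
  rcomp g a -> gquot_comp h x -> gquot_comp (g + h) (a *: x).
Proof.
by move=> ga [y hy <-]; exists (a *: y); [apply: mcompZ|rewrite linearZZ].
Qed.

Definition gquot : gradedModule R := GradedModule gquot_grading gquot_compZ.
End Quotient.

Definition regular_gmod : gradedModule R :=
  @GradedModule G R R^o (@rcomp G R) (rcomp_grading R) (@rcompM G R).

Section Ring.
Variables (I : set R) (hI : is_ideal I) (gI : graded_sub (@rcomp G R) I).

Definition quot_gmod : gradedModule R := @gquot regular_gmod I hI gI.

Definition quot_gring_comp g : set (quotring hI) := [set rclass hI a | a in @rcomp G R g].

Lemma quot_gring_grading : is_grading quot_gring_comp.
Proof. exact: (@gquot_grading regular_gmod I hI gI). Qed.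

Lemma quot_gring_comp1 : quot_gring_comp 0 1.
Proof. by exists 1; [apply: rcomp1|rewrite rmorph1]. Qed.

Lemma quot_gring_compM g h a b :
  quot_gring_comp g a -> quot_gring_comp h b -> quot_gring_comp (g + h) (a * b).
Proof.
by move=> [x gx <-] [y hy <-]; exists (x * y); [apply: rcompM|rewrite rmorphM].
Qed.

Definition quot_gring : gradedRing G :=
  GradedRing quot_gring_grading quot_gring_comp1 quot_gring_compM.

Section Ann.
Variables (M : gradedModule R) (hM : forall a (x : M), I a -> a *: x = 0).

Definition ann_comp g : set (annmod hM) := @mcomp G R M g.

Lemma ann_grading : is_grading ann_comp. Proof. exact: mcomp_grading. Qed.

Lemma ann_compZ g h (a : quot_gring) (x : annmod hM) :
  rcomp g a -> ann_comp h x -> ann_comp (g + h) (a *: x).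
Proof.
move=> [b gb <-] hx; rewrite /ann_comp.
have -> : rclass hI b *: x = b *: (x : M) by exact: annscaleE.
exact: mcompZ.
Qed.

Definition ann_gmod : gradedModule quot_gring :=
  @GradedModule G quot_gring (annmod hM) ann_comp ann_grading ann_compZ.
End Ann.
End Ring.

Definition shift M (a : G) : gradedModule R.
refine (@GradedModule G R M (fun g => @mcomp G R M (a + g)) _ _).
- have [sM gM iM] := mcomp_grading M; split=> [g|x Mx|s f us fC e g gs].
  + exact: sM.
  + have [s sx ->] := gM x Mx; exists s => // v /sx[g gv].
    by exists (g - a); rewrite addrC subrK.
  + have := iM [seq a + g | g <- s] (fun g => f (g - a)).
    rewrite map_inj_uniq; last exact: addrI.
    have H k : mcomp k (f (k - a)) by have := fC (k - a); rewrite addrC subrK.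
    rewrite big_map => /(_ us H) {H}.
    rewrite (eq_bigr f) => [/(_ e (a + g))|k _]; last by rewrite addrC addKr.
    by rewrite mem_map ?gs; [rewrite addrC addKr; apply|exact: addrI].
- by move=> g h b x gb hx; rewrite addrCA; apply: mcompZ.
Defined.

Definition degree0 M N (f : M -> N) := forall g x, mcomp g x -> mcomp g (f x).

Definition gisom M N (f : {linear M -> N}) := degree0 f /\
  exists f' : {linear N -> M}, [/\ degree0 f', cancel f f' & cancel f' f].

Definition star_injective (E : gradedModule R) :=
  forall M N (i : {linear M -> N}) (u : {linear M -> E}),
    degree0 i -> injective i -> degree0 u ->
  exists2 v : {linear N -> E}, degree0 v & forall x, v (i x) = u x.

Definition star_essential (E : gradedModule R) (K : set E) :=
  forall L : set E, is_submod L -> graded_sub (@mcomp G R E) L ->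
    L `&` K `<=` [set 0] -> L `<=` [set 0].

Definition star_envelope M (E : gradedModule R) (j : {linear M -> E}) :=
  [/\ degree0 j, injective j, star_injective E & star_essential (range j)].

Section Morphisms.
Variables (M N : gradedModule R) (f : {linear M -> N}).
Hypothesis f0 : degree0 f.

Lemma ker_submod : is_submod [set x | f x = 0].
Proof. by split=> [|a x y /= fx fy]; rewrite /= ?linear0 // linearP fx fy scaler0 addr0. Qed.

Lemma ker_graded : graded_sub (@mcomp G R M) [set x | f x = 0].
Proof.
move=> x /= fx; have [s [h [us hM _ e]]] := mcompE x.
exists [seq h g | g <- s]; last by rewrite big_map.
move=> v /mapP[g gs ->]; split; last by exists g.
apply: (@mcomp_indep N s (fun g => f (h g))) => // [k|]; first exact: f0.
by rewrite -linear_sum -e.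
Qed.

Lemma range_submod : is_submod (range f).
Proof.
split=> [|a _ _ [x _ <-] [y _ <-]]; first by exists 0; rewrite ?linear0.
by exists (a *: x + y); rewrite // linearP.
Qed.

Lemma range_graded : graded_sub (@mcomp G R N) (range f).
Proof.
move=> _ [x _ <-]; have [s [h [us hM _ e]]] := mcompE x.
exists [seq f (h g) | g <- s]; last by rewrite big_map -linear_sum -e.
by move=> v /mapP[g gs ->]; split; [exists (h g)|exists g; apply: f0].
Qed.
End Morphisms.

Lemma submod0 M : is_submod [set (0 : M)].
Proof. by split=> // a x y /= -> ->; rewrite scaler0 addr0. Qed.

Lemma graded0 M : graded_sub (@mcomp G R M) [set 0].
Proof. by move=> x /= ->; exists [::]; rewrite ?big_nil. Qed.

Lemma graded_sub_grading M (P : set M) : is_submod P -> graded_sub (@mcomp G R M) P ->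
  grading_on P (fun g => P `&` @mcomp G R M g).
Proof.
move=> hP gP; have sP := is_submod_subgroup hP; split=> [g|x /gP|s f us fC].
- split=> [|x []//]; split=> [|x y [Px Mx] [Py My]].
    by split; apply: subgroup0 => //; apply: mcomp_subgroup.
  by split; apply: subgroupB => //; apply: mcomp_subgroup.
- by apply: fin_sums_incl => v [Pv [g Mv]]; exists g.
- by apply: mcomp_indep => // g; have [] := fC g.
Qed.

Section GradedSubmodule.
Variables (M : gradedModule R) (P : set M).
Hypotheses (hP : is_submod P) (gP : graded_sub (@mcomp G R M) P).

Lemma submodule_compZ g h a x : rcomp g a -> (P `&` @mcomp G R M h) x ->
  (P `&` @mcomp G R M (g + h)) (a *: x).
Proof. by move=> ga [Px hx]; split; [apply: is_submodZ|apply: mcompZ]. Qed.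

Definition submodule : gradedModule R :=
  gsub hP (graded_sub_grading hP gP) submodule_compZ.

Lemma submodule_pull (Q : set M) : is_submod Q -> is_submod [set x : submod hP | Q (submod_val x)].
Proof.
move=> [Q0 QL]; split=> [|a x y Qx Qy]; first by rewrite /mkset raddf0.
by rewrite /mkset linearP; apply: QL.
Qed.

Lemma submodule_pull_graded (Q : set M) : is_submod Q -> graded_sub (@mcomp G R M) Q ->
  graded_sub (@mcomp G R submodule) [set x : submod hP | Q (submod_val x)].
Proof.
move=> hQ gQ x Qx; have [s [f [us fM _ e]]] := @mcompE submodule x.
exists [seq f g | g <- s]; last by rewrite big_map.
move=> _ /mapP[g gs ->]; split; last by exists g.
apply: (graded_sub_sum (mcomp_grading M) (is_submod_subgroup hQ) gQ us
          (f := fun g => submod_val (f g))) gs => [k|].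
  by have [] := fM k.
by rewrite -(raddf_sum (@submod_val R M P hP)) -e.
Qed.
End GradedSubmodule.

Section StarHom.
Variables A B : gradedModule R.

Definition hom_deg (a : G) : set (A -> B) :=
  [set f | linear f /\ forall g x, mcomp g x -> mcomp (g + a) (f x)].

(* *Hom_R(A, B), realized inside the module of all maps A -> B. *)
Definition star_hom_set : set (A -> B) := fin_sums (homog hom_deg).

Lemma hom_deg_subgroup a : subgroup (hom_deg a).
Proof.
split=> [|f f' [fL fM] [gL gM]].
  split=> [b x y|g x _]; first by rewrite /= scaler0 addr0.
  exact: (subgroup0 (mcomp_subgroup B (g + a))).
split=> [b x y|g x Mx].
  rewrite /GRing.add /GRing.opp /= fL gL.
  by rewrite scalerBr opprD addrACA.
by apply: (@subgroupB _ _ (f x) (f' x)); [apply: mcomp_subgroup|apply: fM|apply: gM].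
Qed.

Lemma hom_degZ g a b f : rcomp g b -> hom_deg a f -> hom_deg (g + a) (b *: f).
Proof.
move=> gb [fL fM]; split=> [c x y|h x Mx].
  change (b *: f (c *: x + y) = c *: (b *: f x) + b *: f y).
  by rewrite fL scalerDr !scalerA mulrC.
change (mcomp (h + (g + a)) (b *: f x)).
by rewrite addrCA; apply: mcompZ => //; apply: fM.
Qed.

Lemma star_hom_submod : @is_submod R (A -> B) star_hom_set.
Proof.
apply: is_submodP.
  by apply: fin_sums_subgroup => f; apply: homogN; exact: hom_deg_subgroup.
move=> b _ [s sH ->]; rewrite scaler_sumr.
apply: subgroup_sum => [|f fs].
  by apply: fin_sums_subgroup => k; apply: homogN; exact: hom_deg_subgroup.
have [t [c [_ cR _ ->]]] := grading_homogE (rcomp_grading R) (I : setT b).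
have [a fa] := sH f fs; exists [seq c g *: f | g <- t].
  by move=> _ /mapP[g gt ->]; exists (g + a); apply: hom_degZ.
by rewrite big_map scaler_suml.
Qed.

Lemma star_hom_grading : grading_on star_hom_set hom_deg.
Proof.
split=> [a|//|s f us fH e a as_].
  split; first exact: hom_deg_subgroup.
  by move=> f fa; apply: fin_sums_id; exists a.
have key g x : mcomp g x -> f a x = 0.
  move=> Mx; have := @mcomp_indep B [seq g + b | b <- s] (fun h => f (h - g) x).
  rewrite map_inj_uniq; last exact: addrI.
  have H k : mcomp k (f (k - g) x).
    by have [_ /(_ _ _ Mx)] := fH (k - g); rewrite addrC subrK.
  rewrite big_map (eq_bigr (f^~ x)) => [|k _]; last by rewrite addrC addKr.
  have -> : \sum_(k <- s) f k x = 0.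
    by have := congr1 (fun k => k x) e; rewrite fct_sumE.
  move=> /(_ us H erefl (g + a)); rewrite mem_map; last exact: addrI.
  by rewrite addrC addKr; apply.
apply/funext => x; have [t [h [_ hM _ ->]]] := mcompE x.
have [fL _] := fH a; pose F := GRing.isLinear.Build _ _ _ _ (f a) fL.
pose f_ : {linear A -> B} := HB.pack (f a) F.
have -> : f a (\sum_(g <- t) h g) = \sum_(g <- t) f a (h g) by exact: (linear_sum f_).
apply: big1 => k _; exact: key (hM k).
Qed.

Definition star_hom : gradedModule R := gsub star_hom_submod star_hom_grading hom_degZ.
End StarHom.

Section Post.
Variables (A B B' : gradedModule R) (u : {linear B -> B'}).
Hypothesis u0 : degree0 u.

Lemma star_hom_post_subproof (f : star_hom A B) : star_hom_set (u \o submod_val f).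
Proof.
have [s sH ->] := submodP f.
have -> : u \o (\sum_(v <- s) v) = \sum_(v <- s) (u \o v).
  by apply/funext => x; rewrite !fct_sumE /= linear_sum.
exists [seq u \o v | v <- s]; last by rewrite big_map.
move=> _ /mapP[v /sH[a [vL vM]] ->]; exists a; split=> [b x y|g x Mx] /=.
  by rewrite vL linearP.
by apply: u0; apply: vM.
Qed.

Definition star_hom_post_fun (f : star_hom A B) : star_hom A B' :=
  to_submod (star_hom_submod A B') (star_hom_post_subproof f).

Lemma star_hom_post_linear : linear star_hom_post_fun.
Proof.
move=> a f g; apply: submod_val_inj; rewrite [RHS]linearP; apply/funext => x.
change (u (submod_val (a *: f + g) x) = a *: u (submod_val f x) + u (submod_val g x)).
have -> : submod_val (a *: f + g) = a *: submod_val f + submod_val g by exact: linearP.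
exact: linearP.
Qed.

HB.instance Definition _ := GRing.isLinear.Build R (star_hom A B) (star_hom A B') _
  star_hom_post_fun star_hom_post_linear.

Definition star_hom_post : {linear star_hom A B -> star_hom A B'} := star_hom_post_fun.

Lemma star_hom_post_degree0 : degree0 star_hom_post.
Proof.
move=> a f [fL fM]; split=> [b x y|g x Mx] /=; first by rewrite fL linearP.
by apply: u0; apply: fM.
Qed.
End Post.

End GradedModules.

Section DirectSum.
Variables (G : zmodType) (R : gradedRing G) (L : Type) (E : L -> gradedModule R).

Definition dprod : Type := forall l, E l.

HB.instance Definition _ := gen_eqMixin dprod.
HB.instance Definition _ := gen_choiceMixin dprod.

Definition dprod_zero : dprod := fun l => 0.
Definition dprod_add (f g : dprod) : dprod := fun l => f l + g l.
Definition dprod_opp (f : dprod) : dprod := fun l => - f l.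
Definition dprod_scale (a : R) (f : dprod) : dprod := fun l => a *: f l.

Lemma dprod_addA : associative dprod_add.
Proof. by move=> f g h; apply/functional_extensionality_dep => l; apply: addrA. Qed.
Lemma dprod_addC : commutative dprod_add.
Proof. by move=> f g; apply/functional_extensionality_dep => l; apply: addrC. Qed.
Lemma dprod_add0 : left_id dprod_zero dprod_add.
Proof. by move=> f; apply/functional_extensionality_dep => l; apply: add0r. Qed.
Lemma dprod_addN : left_inverse dprod_zero dprod_opp dprod_add.
Proof. by move=> f; apply/functional_extensionality_dep => l; apply: addNr. Qed.

HB.instance Definition _ :=
  GRing.isZmodule.Build dprod dprod_addA dprod_addC dprod_add0 dprod_addN.

Lemma dprod_scaleA a b f : dprod_scale a (dprod_scale b f) = dprod_scale (a * b) f.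
Proof. by apply/functional_extensionality_dep => l; apply: scalerA. Qed.
Lemma dprod_scale1 : left_id 1 dprod_scale.
Proof. by move=> f; apply/functional_extensionality_dep => l; apply: scale1r. Qed.
Lemma dprod_scaleDr : right_distributive dprod_scale +%R.
Proof. by move=> a f g; apply/functional_extensionality_dep => l; apply: scalerDr. Qed.
Lemma dprod_scaleDl f : {morph dprod_scale^~ f : a b / a + b}.
Proof. by move=> a b; apply/functional_extensionality_dep => l; apply: scalerDl. Qed.

HB.instance Definition _ := GRing.Zmodule_isLmodule.Build R dprod
  dprod_scaleA dprod_scale1 dprod_scaleDr dprod_scaleDl.

Definition dsum_set : set dprod := [set f | finite_set [set l | f l <> 0]].

Definition dsum_comp (g : G) : set dprod := [set f | dsum_set f /\ forall l, mcomp g (f l)].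

Lemma dprod_sumE (I : Type) (s : seq I) (F : I -> dprod) l :
  (\sum_(i <- s) F i) l = \sum_(i <- s) F i l.
Proof. by elim: s => [|i s IH]; rewrite ?big_nil // !big_cons -IH. Qed.

Lemma dsum_submod : is_submod dsum_set.
Proof.
split=> [|a f g ff fg]; rewrite /dsum_set /=.
  by rewrite (_ : mkset _ = set0) //; apply/seteqP; split=> l //=.
have := ff; have := fg; rewrite /dsum_set /= => {}fg {}ff.
have : finite_set ([set l | f l <> 0] `|` [set l | g l <> 0]) by rewrite finite_setU.
apply: sub_finite_set => l /= H.
have [fl|] := pselect (f l = 0); last by left.
right=> gl; apply: H; change (a *: f l + g l = 0).
by rewrite fl gl scaler0 addr0.
Qed.

Lemma dsum_grading : grading_on dsum_set dsum_comp.
Proof.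
have cS g : subgroup (dsum_comp g).
  split=> [|f f' [fs fM] [gs gM]].
    by split=> [|l]; [case: dsum_submod|exact: (subgroup0 (mcomp_subgroup (E l) g))].
  split=> [|l]; first by apply: subgroupB => //; apply: is_submod_subgroup dsum_submod.
  by apply: (@subgroupB _ _ (f l) (f' l)) => //; apply: mcomp_subgroup.
split=> [g|f fs|s f us fC e g gs]; first by split=> // f [].
- pose s l := sval (cid (mcompE (f l))).
  pose h l := sval (cid (svalP (cid (mcompE (f l))))).
  have H l : [/\ uniq (s l), forall g, mcomp g (h l g), forall g, g \notin s l -> h l g = 0
      & f l = \sum_(g <- s l) h l g] by exact: (svalP (cid (svalP (cid (mcompE (f l)))))).
  have h0 l g : f l = 0 -> h l g = 0.
    have [us hM hn e] := H l; rewrite e => e0.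
    have [gs|/hn//] := boolP (g \in s l).
    exact: mcomp_indep hM e0 _ gs.
  have /(@finite_seqP {classic L})[t tE] := fs.
  pose U := undup (flatten [seq s l | l : {classic L} <- t]).
  exists [seq (fun l => h l g) : dprod | g <- U].
    move=> _ /mapP[g gU ->]; exists g; split=> [|l]; last by have [] := H l.
    apply: sub_finite_set fs => l /=; apply: contra_not => fl; exact: h0.
  apply/functional_extensionality_dep => l; rewrite big_map dprod_sumE.
  have [fl|fl] := pselect (f l = 0).
    by rewrite fl big1 // => g _; apply: h0.
  have lt : (l : {classic L}) \in t.
    have : [set l | f l <> 0] l by [].
    by rewrite tE.
  have [us hM hn ->] := H l.
  rewrite [RHS](bigID (mem (s l))) /= [X in _ + X]big1 ?addr0 => [|g /hn //].
  rewrite -[RHS]big_filter; apply: perm_big; apply: uniq_perm => //.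
    by rewrite filter_uniq ?undup_uniq.
  move=> g; rewrite mem_filter mem_undup; case gs: (g \in s l) => //=.
  by apply/esym/flattenP; exists (s l) => //; apply/mapP; exists (l : {classic L}).
- apply/functional_extensionality_dep => l.
  apply: (@mcomp_indep _ _ (E l) s (fun g => f g l)) gs => // [k|].
    by have [] := fC k.
  by rewrite -dprod_sumE e.
Qed.

Lemma dsum_compZ g h a (f : dprod) :
  rcomp g a -> dsum_comp h f -> dsum_comp (g + h) (a *: f).
Proof.
move=> ga [fs fM]; split=> [|l]; first by apply: is_submodZ dsum_submod _.
exact: (mcompZ ga (fM l)).
Qed.

Definition dsum : gradedModule R := gsub dsum_submod dsum_grading dsum_compZ.

End DirectSum.

Section Complexes.
Variables (G : zmodType) (R : gradedRing G).

Record complex := Complex {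
  cobj :> nat -> gradedModule R;
  cdiff : forall i, {linear cobj i -> cobj i.+1};
  cdiff0 : forall i, degree0 (cdiff i);
  cdiffK : forall i x, cdiff i.+1 (cdiff i x) = 0 }.

Section Cohomology.
Variables (C : complex) (i : nat).

Definition cocycle : set (C i) := [set x | cdiff C i x = 0].

Definition coboundary : set (C i) :=
  match i with 0 => [set 0] | j.+1 => range (cdiff C j) end.

Lemma coboundary_submod : is_submod coboundary.
Proof. by rewrite /coboundary; case: i => [|j]; [apply: submod0|apply: range_submod]. Qed.

Lemma coboundary_graded : graded_sub (@mcomp G R (C i)) coboundary.
Proof.
rewrite /coboundary; case: i => [|j]; first exact: graded0.
exact/range_graded/cdiff0.
Qed.

Definition cocycles : gradedModule R :=
  submodule (ker_submod (cdiff C i)) (ker_graded (@cdiff0 C i)).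

Definition cohomology : gradedModule R :=
  @gquot G R cocycles [set x | coboundary (submod_val x)]
    (submodule_pull (ker_submod (cdiff C i)) coboundary_submod)
    (submodule_pull_graded coboundary_submod coboundary_graded).
End Cohomology.

Section HomComplex.
Variables (A : gradedModule R) (C : complex).

Lemma hom_cdiffK i (f : star_hom A (C i)) :
  star_hom_post A (@cdiff0 C i.+1) (star_hom_post A (@cdiff0 C i) f) = 0.
Proof.
apply: submod_val_inj; rewrite [RHS]raddf0; apply/funext => x.
exact: cdiffK.
Qed.

Definition hom_complex : complex := @Complex (fun i => star_hom A (C i))
  (fun i => star_hom_post A (@cdiff0 C i))
  (fun i => star_hom_post_degree0 (@cdiff0 C i)) hom_cdiffK.
End HomComplex.

Section Resolutions.
Variable N : gradedModule R.

Definition star_inj_resolution (I : complex) (e : {linear N -> I 0%N}) :=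
  [/\ degree0 e, injective e, range e = @cocycle I 0,
      forall i, range (cdiff I i) = @cocycle I i.+1
    & forall i, star_injective (I i)].

(* Minimality: each term is a *injective envelope of the kernel of its differential. *)
Definition minimal_star_inj_resolution (I : complex) (e : {linear N -> I 0%N}) :=
  star_inj_resolution e /\ forall i, star_essential (@cocycle I i).

Definition const_complex : complex :=
  @Complex (fun=> N) (fun=> \0) (fun _ g x _ => subgroup0 (mcomp_subgroup N g))
    (fun _ _ => erefl).

(* A chosen *injective resolution of N. The graded category has enough injectives,
   so the default value is never used. *)
Definition star_resolution : complex :=
  if pselect (exists I, exists e : {linear N -> cobj I 0%N}, star_inj_resolution e) is left h
  then sval (cid h) else const_complex.

Definition star_ext (A : gradedModule R) (i : nat) : gradedModule R :=
  cohomology (hom_complex A star_resolution) i.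
End Resolutions.

Lemma star_hom_linear (A B : gradedModule R) (f : star_hom A B) : linear (submod_val f).
Proof.
move=> a x y; have [s sH ->] := submodP f; rewrite !fct_sumE scaler_sumr -big_split.
by apply: eq_big_seq => v /sH[g [vL _]]; rewrite vL.
Qed.

Lemma star_ext_ann (I : set R) (hI : is_ideal I) (gI : graded_sub (@rcomp G R) I)
    (N : gradedModule R) i a (x : star_ext N (quot_gmod hI gI) i) : I a -> a *: x = 0.
Proof.
move=> Ia; rewrite -(qreprK x) -linearZZ; apply/qclass0.
set f := qrepr x; change (coboundary (submod_val (a *: f))).
suff -> : a *: f = 0 by rewrite raddf0; exact: (@coboundary_submod _ _).1.
apply: submod_val_inj; rewrite linearZZ raddf0.
apply: submod_val_inj; rewrite linearZZ raddf0.
apply/funext => t; set k := submod_val (submod_val f).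
have kL : linear k by exact: star_hom_linear.
have k0 : k 0 = 0.
  by have := kL (-1) 0 0; rewrite scaler0 add0r scaleN1r addNr.
have kZ : k (a *: t) = a *: k t by rewrite -[a *: t]addr0 kL k0 addr0.
change (a *: k t = 0); rewrite -kZ (_ : a *: t = 0) //.
rewrite -(qreprK t) -linearZZ; apply/qclass0.
by rewrite /GRing.scale /= mulrC; apply: (@is_submodZ R R^o).
Qed.

End Complexes.

Section GradedLocalization.
Variables (G : zmodType) (R : gradedRing G) (S : multSet R).
Hypothesis hS : ms_set S `<=` homog (@rcomp G R).

Section Module.
Variable M : gradedModule R.

Definition loc_comp (g : G) : set (loc S M) :=
  [set y | exists h (x : M) (s : den S),
     [/\ rcomp h (dval s), mcomp (g + h) x & y = frac x s]].

Lemma loc_comp_subgroup g : subgroup (loc_comp g).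
Proof.
split=> [|_ _ [h [x [s [sh xM ->]]]] [k [y [t [tk yM ->]]]]].
  exists 0, 0, (den1 S); split; first exact: rcomp1.
    exact: (subgroup0 (mcomp_subgroup _ _)).
  by rewrite frac0.
rewrite -fracN fracD; exists (h + k), (dval t *: x + dval s *: - y), (denM s t).
split=> //; first by rewrite dvalM; apply: rcompM.
apply: (subgroupD (mcomp_subgroup _ _)).
  by rewrite addrA addrC; apply: mcompZ.
rewrite addrCA; apply: mcompZ => //.
exact: (subgroupN (mcomp_subgroup _ _)).
Qed.

Lemma loc_common (s : seq G) (f : G -> loc S M) : (forall g, loc_comp g (f g)) ->
  exists (d : den S) k (F : G -> M), [/\ rcomp k (dval d), forall g, mcomp (g + k) (F g)
    & forall g, g \in s -> f g = frac (F g) d].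
Proof.
move=> fC; elim: s => [|g0 s [d [k [F [dk FM FE]]]]].
  exists (den1 S), 0, (fun=> 0); split=> // [|g]; first exact: rcomp1.
  exact: (subgroup0 (mcomp_subgroup _ _)).
have [h [x [t [th xM e]]]] := fC g0.
exists (denM d t), (k + h), (fun g => if g == g0 then dval d *: x else dval t *: F g).
split=> [|g|g]; first by rewrite dvalM; apply: rcompM.
- case: eqP => [->|_]; first by rewrite addrCA; apply: mcompZ.
  by rewrite addrA addrC; apply: mcompZ.
- rewrite inE; case: eqP => [-> _|_ /= /FE ->].
    by rewrite e; apply: frac_eq1; rewrite dvalM !scalerA mulrC [dval t * _]mulrC.
  by apply: frac_eq1; rewrite dvalM !scalerA.
Qed.

Lemma loc_grading : is_grading loc_comp.
Proof.
split=> [g|y _|s f us fC]; first by split=> //; apply: loc_comp_subgroup.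
- elim/locP: y => x d; have [h dh] := hS (denP d).
  have [s [f [us fM _ ->]]] := mcompE x.
  exists [seq frac (f g) d | g <- s]; last by rewrite big_map frac_sum.
  move=> _ /mapP[g gs ->]; exists (g - h), h, (f g), d; split=> //.
  by rewrite subrK.
- have [d [k [F [dk FM FE]]]] := loc_common s fC.
  rewrite (eq_big_seq _ FE) -frac_sum -(frac0 M (den1 S)) => /frac_eq[u Su].
  rewrite dval1 scale1r !scaler0 scaler_sumr => e g gs.
  have [l ul] := hS Su; rewrite FE //.
  transitivity (frac (0 : M) (den1 S)); last exact: frac0.
  apply/frac_eq; exists u => //; rewrite dval1 scale1r !scaler0.
  have := @mcomp_indep _ _ M [seq l + (g + k) | g <- s] (fun j => u *: F (j - l - k)).
  have inj : injective (fun g => l + (g + k)) by move=> a b /addrI /addIr.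
  rewrite (map_inj_uniq inj) big_map (eq_bigr (fun g => u *: F g)).
    move=> /(_ us _ e (l + (g + k))); rewrite (mem_map inj).
    rewrite [l + _]addrC addrK addrK; apply=> // j.
    have := mcompZ ul (FM (j - l - k)).
    by rewrite subrK [l + _]addrC subrK.
  by move=> j _; rewrite [l + _]addrC addrK addrK.
Qed.
End Module.

Definition gloc_rcomp g : set (locring S) := @loc_comp (regular_gmod R) g.

Lemma gloc_rcomp_grading : is_grading gloc_rcomp.
Proof. exact: (@loc_grading (regular_gmod R)). Qed.

Lemma gloc_rcomp1 : gloc_rcomp 0 1.
Proof.
by exists 0, 1, (den1 S); split=> //; rewrite ?addr0; [exact: rcomp1|exact: rcomp1].
Qed.

Lemma loc_compZ (M : gradedModule R) g h (a : locring S) (x : loc S M) :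
  gloc_rcomp g a -> @loc_comp M h x -> @loc_comp M (g + h) (a *: x).
Proof.
move=> [k [b [s [sk bR ->]]]] [l [y [t [tl yM ->]]]].
exists (k + l), ((b : R) *: y), (denM s t); split; last exact: fracZ.
  by rewrite dvalM; apply: rcompM.
by rewrite addrACA; apply: mcompZ.
Qed.

Lemma gloc_rcompM g h (a b : locring S) :
  gloc_rcomp g a -> gloc_rcomp h b -> gloc_rcomp (g + h) (a * b).
Proof. exact: (@loc_compZ (regular_gmod R)). Qed.

Definition gloc_ring : gradedRing G :=
  GradedRing gloc_rcomp_grading gloc_rcomp1 gloc_rcompM.

Definition gloc_mod (M : gradedModule R) : gradedModule gloc_ring :=
  @GradedModule G gloc_ring (loc S M) (@loc_comp M) (loc_grading M) (@loc_compZ M).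
End GradedLocalization.

Section IdealGen.
Variable R : comPzRingType.

Lemma ideal_gen_ideal (A : set R) : is_ideal (ideal_gen A).
Proof.
apply: (@is_submodP R R^o).
  apply: fin_sums_subgroup => _ [a [x Ax ->]].
  by exists (- a), x; rewrite ?mulNr.
move=> a _ [s sA ->]; rewrite scaler_sumr; exists [seq a * v | v <- s].
  by move=> _ /mapP[v /sA[b [x Ax ->]] ->]; exists (a * b), x; rewrite ?mulrA.
by rewrite big_map.
Qed.
End IdealGen.

Section AtPrime.
Variables (G : zmodType) (R : gradedRing G).

(* the elements of *Spec(R) *)
Record gprime := GPrime {
  gp_set :> set R;
  gp_prime : is_prime gp_set;
  gp_graded : graded_sub (@rcomp G R) gp_set }.

Lemma gp_ideal (p : gprime) : is_ideal p.
Proof. by case: (gp_prime p). Qed.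

Definition gprime_quot (p : gprime) : gradedModule R :=
  quot_gmod (gp_ideal p) (@gp_graded p).

Variable p : gprime.

Definition homog_compl : set R := [set s | homog (@rcomp G R) s /\ ~ gp_set p s].

Lemma homog_compl1 : homog_compl 1.
Proof. by split; [exists 0; apply: rcomp1|case: (gp_prime p)]. Qed.

Lemma homog_complM s t : homog_compl s -> homog_compl t -> homog_compl (s * t).
Proof.
move=> [[g sg] ps] [[h th] pt]; split; first by exists (g + h); apply: rcompM.
by have [_ _ pM] := gp_prime p; move=> /pM[].
Qed.

Definition homog_compl_mult : multSet R := MultSet homog_compl1 homog_complM.

Lemma homog_compl_homog : ms_set homog_compl_mult `<=` homog (@rcomp G R).
Proof. by move=> s []. Qed.

Definition hloc_ring : gradedRing G := gloc_ring homog_compl_homog.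

Definition hloc_mod (M : gradedModule R) : gradedModule hloc_ring :=
  gloc_mod homog_compl_homog M.

Definition hloc_map (a : R) : hloc_ring := rfrac a (den1 homog_compl_mult).

(* the ideal pR_(p) *)
Definition hloc_ideal : set hloc_ring := ideal_gen [set hloc_map a | a in gp_set p].

Lemma hloc_ideal_ideal : is_ideal hloc_ideal.
Proof. exact: ideal_gen_ideal. Qed.

Lemma hloc_map_sum (s : seq R) : hloc_map (\sum_(a <- s) a) = \sum_(a <- s) hloc_map a.
Proof. exact: (@frac_sum R homog_compl_mult R^o). Qed.

Lemma hloc_map_homog g a : rcomp g a -> rcomp g (hloc_map a).
Proof.
move=> ga; exists 0, a, (den1 homog_compl_mult); split=> //; first exact: rcomp1.
by rewrite addr0.
Qed.

Lemma hloc_ideal_graded : graded_sub (@rcomp G hloc_ring) hloc_ideal.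
Proof.
pose H : set hloc_ring := hloc_ideal `&` homog (@rcomp G hloc_ring).
have sH : subgroup (fin_sums H).
  apply: fin_sums_subgroup => v [Iv [g gv]]; split.
    exact: (subgroupN (is_submod_subgroup hloc_ideal_ideal)).
  exists g; apply: subgroupN => //.
  exact: (mcomp_subgroup (regular_gmod hloc_ring)).
change (hloc_ideal `<=` fin_sums H).
apply: fin_sums_sub => // _ [b [_ [a pa <-] ->]].
have [t tP ->] := gp_graded pa; rewrite hloc_map_sum mulr_sumr.
apply: subgroup_sum => // c /tP[pc [h hc]].
have [s [f [_ fR _ ->]]] := grading_homogE (rcomp_grading hloc_ring) (I : setT b).
rewrite mulr_suml; apply: subgroup_sum => // g _; apply: fin_sums_id; split.
  by apply: fin_sums_id; exists (f g), (hloc_map c) => //; exists c.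
by exists (g + h); apply: rcompM => //; apply: hloc_map_homog.
Qed.

(* T = R_(p) / pR_(p), as an R_(p)-module and as a ring *)
Definition residue_mod : gradedModule hloc_ring :=
  quot_gmod hloc_ideal_ideal hloc_ideal_graded.

Definition residue_ring : gradedRing G := quot_gring hloc_ideal_ideal hloc_ideal_graded.

(* *Ext^i(T, M_(p)) over R_(p), with the induced action of the ring T *)
Definition residue_ext (M : gradedModule R) (i : nat) : gradedModule residue_ring :=
  ann_gmod hloc_ideal_ideal hloc_ideal_graded
    (@star_ext_ann G hloc_ring _ hloc_ideal_ideal hloc_ideal_graded (hloc_mod M) i).

End AtPrime.

(* the components of M^phi *)
Definition coarsen (G H V : zmodType) (phi : {additive G -> H}) (C : G -> set V) (h : H) :
    set V :=
  fin_sums [set x | exists2 g, phi g = h & C g x].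

Definition is_basis (T : comPzRingType) (V : lmodType T) (K : set T) (W B : set V) :=
  [/\ B `<=` W,
      forall w, W w -> exists (s : seq V) (c : V -> T),
        [/\ forall v, v \in s -> B v, forall v, K (c v) & w = \sum_(v <- s) c v *: v]
    & forall (s : seq V) (c : V -> T), uniq s -> (forall v, v \in s -> B v) ->
        (forall v, K (c v)) -> \sum_(v <- s) c v *: v = 0 -> forall v, v \in s -> c v = 0].

(* W is free over the subring K of T, and its rank is the cardinality of A. *)
Definition has_rank (T : comPzRingType) (V : lmodType T) (K : set T) (W : set V)
    (L : Type) (A : set L) :=
  exists2 B : set V, is_basis K W B & (B #= A)%card.

Section Multigraded.
Variables (r : nat) (R : gradedRing 'rV[int]_r).

Definition positively_graded := forall n : 'rV[int]_r,
  ~ (forall k, 0 <= n 0 k) -> @rcomp _ R n `<=` [set 0].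

Definition subring (K : set R) :=
  [/\ K 1, forall a b, K a -> K b -> K (a - b) & forall a b, K a -> K b -> K (a * b)].

(* R = R_0[R_{e_1}, ..., R_{e_r}] *)
Definition standard := forall K : set R, subring K ->
  rcomp 0 `<=` K -> (forall k : 'I_r, rcomp (delta_mx 0 k) `<=` K) -> K = setT.

Definition dir (p : gprime R) : {set 'I_r} :=
  finset (fun k => `[< rcomp (delta_mx 0 k) `<=` gp_set p >]).

(* enum_val lists the elements of dir p in increasing order. *)
Definition dir_proj (p : gprime R) (n : 'rV[int]_r) : 'rV[int]_#|dir p| :=
  \row_(k < #|dir p|) n 0 (enum_val k).

Lemma dir_proj_additive p : zmod_morphism (dir_proj p).
Proof. by move=> a b; apply/rowP => k; rewrite !mxE. Qed.
HB.instance Definition _ p :=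
  GRing.isZmodMorphism.Build 'rV[int]_r 'rV[int]_#|dir p| (dir_proj p) (dir_proj_additive p).

End Multigraded.

(* Main.v *)
(* Let S be the set of homogeneous elements outside p.  An element of S acts bijectively on
   *E(R/q) when it is not in q (multiplication by it is injective, hence splits, and the
   complement of the image is killed), and every element is killed by a power of it
   otherwise (noetherianity).  Hence the localization map E -> E_S has a graded R-linear
   section for every term E of the resolution, so E_S is *injective over R_S and the
   localized complex is a *injective resolution of M_S; it computes *Ext up to homotopy.
   By minimality its differentials vanish on the elements killed by p, so *Ext^i is the
   socle (0 : p) of E_S.  The summands with q <> p contribute nothing to the socle, and each
   summand with q = p contributes one free generator, of degree n.  Finally, R being
   standard, R_g is contained in p unless phi(g) = 0, so T is concentrated in degree 0. *)

Require Import Defs.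
From HB Require Import structures.
From mathcomp Require Import all_boot all_order all_algebra.
From mathcomp Require Import boolp classical_sets functions cardinality.
From mathcomp Require Import ring.

Set Implicit Arguments.
Unset Strict Implicit.
Unset Printing Implicit Defensive.

Import GRing.Theory.
Local Open Scope classical_set_scope.
Local Open Scope ring_scope.

Local Notation frac := Defs.frac.

(** * Homogeneous components, essential submodules and comparison of *injective resolutions *)

Section GradedModules.
Variables (G : zmodType) (R : gradedRing G).

(** Uniqueness of the decomposition: [x] alone in degree [k] is a second one, so the differences of
    components sum to zero and independence applies. *)
Lemma homog_component (M : gradedModule R) k (x : M) (s : seq G) (f : G -> M) :
  mcomp k x -> uniq s -> (forall g, mcomp g (f g)) -> x = \sum_(g <- s) f g ->
  forall g, g \in s -> g != k -> f g = 0.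
Proof.
move=> kx us fM e g gs gk.
have H h : mcomp h ((if h \in s then f h else 0) - (if h == k then x else 0)).
  apply: (subgroupB (mcomp_subgroup _ _)); last first.
    by case: eqP => [->//|_]; exact: (subgroup0 (mcomp_subgroup _ _)).
  by case: ifP => // _; exact: (subgroup0 (mcomp_subgroup _ _)).
have [U [uU mU]] : exists U, uniq U /\ U =i k :: s.
  by exists (undup (k :: s)); split; [apply: undup_uniq|apply: mem_undup].
have := @mcomp_indep _ _ M U _ uU H.
rewrite sumrB -!big_mkcond => /(_ _ g); rewrite gs (negPf gk) subr0; apply; last first.
  by rewrite mU inE gs orbT.
apply/eqP; rewrite subr_eq0; apply/eqP.
rewrite -[LHS]big_filter -[RHS]big_filter [RHS](perm_big [:: k]) /=.
  rewrite big_seq1 [RHS]e; apply: perm_big; apply: uniq_perm => //.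
    by rewrite filter_uniq.
  by move=> h; rewrite mem_filter mU inE; case: (h \in s); rewrite ?orbT.
apply: uniq_perm => //; first by rewrite filter_uniq.
by move=> h; rewrite mem_filter mU !inE; case: eqP.
Qed.

(** The components of [x] off degree [k] map to components of the homogeneous [u x], hence to zero,
    and [u] is injective. *)
Lemma degree0_reflect (M N : gradedModule R) (u : {linear M -> N}) k x :
  degree0 u -> injective u -> mcomp k (u x) -> mcomp k x.
Proof.
move=> u0 uI ku; have [s [f [us fM _ e]]] := mcompE x.
have e' : u x = \sum_(g <- s) u (f g) by rewrite e linear_sum.
have f0 g : g \in s -> g != k -> f g = 0.
  move=> gs gk; apply: uI; rewrite linear0.
  by apply: (homog_component ku us _ e' gs gk) => h; apply: u0.
rewrite e; apply: (subgroup_sum (mcomp_subgroup _ _)) => g gs.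
have [<-//|gk] := eqVneq g k.
by rewrite f0 //; exact: (subgroup0 (mcomp_subgroup _ _)).
Qed.

(** Essentiality is applied to the cyclic submodule [R y]. If [b *: y] is in [K], so is each of its
    components, [K] being graded; a nonzero one gives the multiplier. *)
Lemma essential_homog (V : gradedModule R) (K : set V) g (y : V) :
  is_submod K -> graded_sub (@mcomp G R V) K -> star_essential K ->
  mcomp g y -> y <> 0 -> exists h b, [/\ rcomp h b, K (b *: y) & b *: y <> 0].
Proof.
move=> hK gK ess gy y0; apply: contrapT => H.
pose L : set V := [set z | exists b : R, z = b *: y].
have hL : is_submod L.
  split=> [|a _ _ [b ->] [c ->]]; first by exists 0; rewrite scale0r.
  by exists (a * b + c); rewrite scalerDl scalerA.
have gL : graded_sub (@mcomp G R V) L.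
  move=> _ [b ->]; have [s [f [us fR _ ->]]] := grading_homogE (rcomp_grading R) (I : setT b).
  exists [seq f h *: y | h <- s]; last by rewrite big_map scaler_suml.
  move=> _ /mapP[h hs ->]; split; first by exists (f h).
  by exists (h + g); apply: mcompZ.
apply: y0; apply: (ess L hL gL); last by exists 1; rewrite scale1r.
move=> _ [[b ->] /= Kb]; have [s [f [us fR _ e]]] :=
  grading_homogE (rcomp_grading R) (I : setT b).
rewrite e scaler_suml big1_seq // => h /andP[_ hs].
apply: contrapT => bh0; apply: H; exists h, (f h); split=> //.
(* The components of [b *: y] sit in the degrees of those of [b] shifted by [g], whence the
   reindexing. *)
have inj : injective (fun h => h + g) by move=> ? ? /addIr.
have := @graded_sub_sum _ _ _ _ K (mcomp_grading V) (is_submod_subgroup hK) gK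
  [seq h + g | h <- s] (fun k => f (k - g) *: y).
rewrite (map_inj_uniq inj) big_map => /(_ us).
have E k : mcomp k (f (k - g) *: y) by have := mcompZ (fR (k - g)) gy; rewrite subrK.
move=> /(_ E); rewrite (eq_bigr (fun h => f h *: y)) => [|k _]; last by rewrite addrK.
rewrite -scaler_suml -e => /(_ Kb (h + g)); rewrite (mem_map inj) addrK.
exact.
Qed.

Lemma quotmod_lift (V W : lmodType R) (P : set V) (hP : is_submod P) (u : {linear V -> W}) :
  (forall x, P x -> u x = 0) ->
  exists v : {linear quotmod hP -> W}, forall x, v (qclass hP x) = u x.
Proof.
move=> uP; pose v (x : quotmod hP) := u (qrepr x).
have vE x : v (qclass hP x) = u x.
  apply/eqP; rewrite -subr_eq0 -linearB; apply/eqP/uP.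
  by apply/(qclass_eq hP); rewrite qreprK.
have vL : linear v.
  by move=> a x y; rewrite -(qreprK x) -(qreprK y) -linearP !vE linearP.
pose vl : {linear quotmod hP -> W} := HB.pack v (GRing.isLinear.Build _ _ _ _ v vL).
by exists vl.
Qed.

(** The definition of *injectivity only speaks of injective maps, so [d] and [u] are first factored
    through [A / ker d]. *)
Lemma inj_lift (A B E : gradedModule R) (d : {linear A -> B}) (u : {linear A -> E}) :
  star_injective E -> degree0 d -> degree0 u -> (forall x, d x = 0 -> u x = 0) ->
  exists v : {linear B -> E}, degree0 v /\ forall x, v (d x) = u x.
Proof.
move=> hE d0 u0 du.
pose K := ker_submod d; pose Q := @gquot G R A _ K (ker_graded d0).
have [dl dlE] := @quotmod_lift A B _ K d (fun _ => id).
have [ul ulE] := @quotmod_lift A E _ K u du.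
have [|||v v0 vE] := hE Q B dl ul.
- by move=> g _ [x gx <-]; rewrite /= dlE; exact: (d0 _ _ gx).
- move=> x y; rewrite -(qreprK x) -(qreprK y) /= !dlE => e.
  by apply/(qclass_eq K); rewrite /= linearB e subrr.
- by move=> g _ [x gx <-]; rewrite /= ulE; apply: u0.
by exists v; split=> // x; rewrite -dlE vE ulE.
Qed.

Lemma chain_lift (N : gradedModule R) (I J : complex R) (e : {linear N -> I 0})
    (e' : {linear N -> J 0}) :
  star_inj_resolution e -> star_inj_resolution e' ->
  exists f : forall i, {linear I i -> J i},
    [/\ forall i, degree0 (f i), forall x, f 0 (e x) = e' x
      & forall i x, f i.+1 (cdiff I i x) = cdiff J i (f i x)].
Proof.
move=> [e0 eI eK dK _] [e'0 _ e'K _ JI].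
(* The invariant of the recursion: it is what [inj_lift] needs in order to extend [cdiff J i \o f]
   along [cdiff I i]. *)
pose P i (f : {linear I i -> J i}) :=
  degree0 f /\ forall x, cdiff I i x = 0 -> cdiff J i (f x) = 0.
have [f0 [f00 f0e]] : exists f : {linear I 0 -> J 0}, degree0 f /\ forall x, f (e x) = e' x.
  by apply: inj_lift => // x; rewrite -(linear0 e) => /eI ->; rewrite linear0.
have Pf0 : P 0 f0.
  split=> // x x0; have : @cocycle _ _ I 0 x by [].
  rewrite -eK => -[y _ <-]; rewrite f0e.
  by have : range e' (e' y) by [exists y]; rewrite e'K.
have step i (f : {f | P i f}) : exists f' : {f | P i.+1 f},
    forall x, sval f' (cdiff I i x) = cdiff J i (sval f x).
  case: f => f [fd fP] /=.
  have [|||f' [f'd f'E]] := @inj_lift (I i) (I i.+1) (J i.+1) (cdiff I i)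
    (cdiff J i \o f) (JI _).
  - exact: cdiff0.
  - by move=> g x gx; apply: cdiff0; apply: fd.
  - exact: fP.
  have Pf' : P i.+1 f'.
    split=> // x x0; have : @cocycle _ _ I i.+1 x by [].
    by rewrite -dK => -[y _ <-]; rewrite f'E /= cdiffK.
  by exists (exist _ f' Pf').
pose F : forall i, {f | P i f} := nat_rect _ (exist _ f0 Pf0) (fun i f => sval (cid (step i f))).
exists (fun i => sval (F i)); split=> [i|//|i x]; first by have [] := svalP (F i).
exact: (svalP (cid (step i (F i)))).
Qed.

(** Meant for a composite of two comparison maps minus the identity: it makes any two resolutions of
    [N] homotopy equivalent. *)
Lemma chain_homotopy (N : gradedModule R) (I J : complex R) (e : {linear N -> I 0})
    (e' : {linear N -> J 0}) (f : forall i, {linear I i -> J i}) :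
  star_inj_resolution e -> star_inj_resolution e' ->
  (forall i, degree0 (f i)) -> (forall x, f 0 (e x) = 0) ->
  (forall i x, f i.+1 (cdiff I i x) = cdiff J i (f i x)) ->
  exists h : forall i, {linear I i.+1 -> J i},
    [/\ forall i, degree0 (h i), forall x, f 0 x = h 0 (cdiff I 0 x)
      & forall i x, f i.+1 x = h i.+1 (cdiff I i.+1 x) + cdiff J i (h i x)].
Proof.
move=> [_ _ eK dK _] [_ _ _ _ JI] f0 fe fd.
(* By this invariant [f - d h] vanishes on the kernel of the differential of [I i.+1], so it extends
   along it; the extension is the next homotopy. *)
pose P i (h : {linear I i.+1 -> J i}) :=
  degree0 h /\ forall x, cdiff I i.+1 x = 0 -> f i.+1 x = cdiff J i (h x).
have [h0 [h00 h0E]] : exists h : {linear I 1 -> J 0},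
    degree0 h /\ forall x, h (cdiff I 0 x) = f 0 x.
  apply: inj_lift => // [|x x0]; first exact: cdiff0.
  by have : @cocycle _ _ I 0 x by []; rewrite -eK => -[y _ <-].
have Ph0 : P 0 h0.
  split=> // x x0; have : @cocycle _ _ I 1 x by [].
  by rewrite -dK => -[y _ <-]; rewrite h0E fd.
have step i (h : {h | P i h}) : exists h' : {h | P i.+1 h},
    forall x, f i.+1 x = sval h' (cdiff I i.+1 x) + cdiff J i (sval h x).
  case: h => h [hd hP] /=.
  have [|||h' [h'd h'E]] := @inj_lift (I i.+1) (I i.+2) (J i.+1) (cdiff I i.+1)
    (f i.+1 \- (cdiff J i \o h)) (JI _).
  - exact: cdiff0.
  - move=> g x gx; apply: (subgroupB (mcomp_subgroup _ _)); first exact: f0.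
    by apply: cdiff0; apply: hd.
  - by move=> x /hP /= ->; rewrite subrr.
  have Ph' : P i.+1 h'.
    split=> // x x0; have : @cocycle _ _ I i.+2 x by [].
    by rewrite -dK => -[y _ <-]; rewrite h'E /= linearB cdiffK subr0 fd.
  by exists (exist _ h' Ph') => x /=; rewrite h'E /= subrK.
pose H : forall i, {h | P i h} := nat_rect _ (exist _ h0 Ph0) (fun i h => sval (cid (step i h))).
exists (fun i => sval (H i)); split=> [i|x|i x]; first by have [] := svalP (H i).
  by rewrite /= h0E.
exact: (svalP (cid (step i (H i)))).
Qed.

End GradedModules.

(** * Computing *Ext from any *injective resolution *)

Section Ext.
Variables (G : zmodType) (R : gradedRing G) (N A : gradedModule R).

(** Existence rules out the default branch of [star_resolution]. *)
Lemma star_resolutionP :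
  (exists I, exists e : {linear N -> cobj I 0}, star_inj_resolution e) ->
  exists e : {linear N -> star_resolution N 0}, star_inj_resolution e.
Proof.
by move=> h; rewrite /star_resolution; case: pselect => // h'; apply: svalP (cid h').
Qed.

(** [J] is homotopy equivalent to the chosen resolution, so both give the same *Ext; by hypothesis
    the complex of homomorphisms into [J] has zero differentials and is its own cohomology.
    Surjectivity is stated degree by degree to get homogeneous preimages. *)
Lemma star_ext_trivial_diff (J : complex R) (e : {linear N -> J 0}) i :
  star_inj_resolution e ->
  (forall k (f : star_hom A (J k)) x, cdiff J k (submod_val f x) = 0) ->
  exists psi : {linear star_hom A (J i) -> star_ext N A i},
    [/\ degree0 psi, forall f, psi f = 0 -> f = 0
      & forall g w, mcomp g w -> exists2 f, mcomp g f & psi f = w].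
Proof.
move=> he dA; have [|e' he'] := star_resolutionP; first by exists J, e.
rewrite /star_ext; move: (star_resolution N) e' he' => I e' he'.
have [F [F0 Fe Fd]] := chain_lift he he'.
have [H [H0 He Hd]] := chain_lift he' he.
(* Homotopies to the identity, from [H \o F] here and from [F \o H] next. *)
have [h [h0 hE hd]] : exists h : forall i, {linear J i.+1 -> J i},
    [/\ forall i, degree0 (h i), forall x, H 0%N (F 0%N x) - x = h 0%N (cdiff J 0 x)
      & forall i x, H i.+1 (F i.+1 x) - x = h i.+1 (cdiff J i.+1 x) + cdiff J i (h i x)].
  apply: (@chain_homotopy _ _ N J J e e (fun i => (H i \o F i) \- idfun)) => //=.
  - move=> k g x gx; apply: (subgroupB (mcomp_subgroup _ _)) => //.
    by apply: H0; apply: F0.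
  - by move=> x; rewrite Fe He subrr.
  - by move=> k x; rewrite Fd Hd linearB.
have [h' [h'0 h'E h'd]] : exists h : forall i, {linear I i.+1 -> I i},
    [/\ forall i, degree0 (h i), forall x, F 0%N (H 0%N x) - x = h 0%N (cdiff I 0 x)
      & forall i x, F i.+1 (H i.+1 x) - x = h i.+1 (cdiff I i.+1 x) + cdiff I i (h i x)].
  apply: (@chain_homotopy _ _ N I I e' e' (fun i => (F i \o H i) \- idfun)) => //=.
  - move=> k g x gx; apply: (subgroupB (mcomp_subgroup _ _)) => //.
    by apply: F0; apply: H0.
  - by move=> x; rewrite He Fe subrr.
  - by move=> k x; rewrite Hd Fd linearB.
pose C := hom_complex A I.
have cF (f : star_hom A (J i)) : cdiff C i (star_hom_post A (F0 i) f) = 0.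
  apply: submod_val_inj; rewrite [RHS]raddf0; apply/funext => x /=.
  by rewrite -Fd dA linear0.
pose psi0 f := to_submod (ker_submod (cdiff C i)) (cF f).
have psi0L : linear psi0.
  by move=> a f k; apply: submod_val_inj; rewrite [RHS]linearP /= linearP.
pose psi1 : {linear star_hom A (J i) -> cocycles C i} :=
  HB.pack psi0 (GRing.isLinear.Build _ _ _ _ psi0 psi0L).
pose hC := submodule_pull (ker_submod (cdiff C i)) (coboundary_submod C i).
pose psi : {linear star_hom A (J i) -> cohomology C i} := qclass hC \o psi1.
exists psi; split.
- move=> g f gf; exists (psi1 f) => //.
  by split; [exact: cF|exact: (star_hom_post_degree0 (F0 i) gf)].
(* Injectivity: if [F f] is a coboundary [d z], then [H (F f) = d (H z) = 0] by [dA], and both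
   homotopy terms vanish likewise, so [f = 0]. In degree 0 the only coboundary is 0. *)
- move=> f /(qclass0 hC); change (@coboundary _ _ C i (star_hom_post A (F0 i) f) -> f = 0).
  clear psi psi1 psi0 psi0L hC => cob.
  apply: submod_val_inj; rewrite [RHS]raddf0; apply/funext => x.
  move: f cob {cF}; rewrite {}/C.
  case: i => [f /= e0|k f [z _ zE]].
    have {e0}: F 0%N (submod_val f x) = 0.
      by have := congr1 (fun k => submod_val k x) e0; rewrite raddf0.
    move=> e0; have := hE (submod_val f x).
    by rewrite e0 dA !linear0 sub0r => /eqP; rewrite oppr_eq0 => /eqP.
  have e0 : F k.+1 (submod_val f x) = cdiff I k (submod_val z x).
    by have := congr1 (fun k => submod_val k x) zE.
  have := hd k (submod_val f x).
  rewrite e0 Hd (dA _ (star_hom_post A (H0 k) z)) dA linear0.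
  rewrite (dA _ (star_hom_post A (h0 k) f)) addr0 sub0r => /eqP.
  by rewrite oppr_eq0 => /eqP.
(* Surjectivity: the class of a cocycle [z] comes from [H z], because the second homotopy makes
   [F (H z) - z] a coboundary. *)
- move=> g _ [z [_ gz] <-].
  exists (star_hom_post A (H0 i) (submod_val z)).
    exact: (star_hom_post_degree0 (H0 i) gz).
  apply/(qclass_eq hC); rewrite /mkset raddfB /=.
  have dz : cdiff C i (submod_val z) = 0 by exact: submodP z.
  move: (submod_val z) dz gz; clear psi psi1 psi0 psi0L hC cF z => z dz _.
  have {}dz x : cdiff I i (submod_val z x) = 0.
    by have := congr1 (fun k => submod_val k x) dz; rewrite raddf0.
  move: z dz; case: i => [|k] z dz /=.
    apply: submod_val_inj; rewrite raddfB [RHS]raddf0; apply/funext => x.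
    by have := h'E (submod_val z x); rewrite dz linear0.
  exists (star_hom_post A (h'0 k) z) => //.
  apply: submod_val_inj; rewrite raddfB; apply/funext => x.
  by have := h'd k (submod_val z x); rewrite dz linear0 add0r.
Qed.
End Ext.

(** * Localization of linear maps *)

Section LocalizedMap.
Variables (R : comPzRingType) (S : multSet R).

Lemma frac_eq0 (V : lmodType R) (x : V) (s : den S) :
  frac x s = 0 <-> exists2 u, ms_set S u & u *: x = 0.
Proof.
rewrite -(frac0 V (den1 S)) frac_eq; split=> [[u Su]|[u Su ux]].
  by rewrite dval1 scale1r !scaler0 => ux; exists u.
by exists u; rewrite ?dval1 ?scale1r ?scaler0.
Qed.

Variables (V W : lmodType R) (u : {linear V -> W}).

Definition loc_map (y : loc S V) : loc S W := frac (u (num_den y).1) (num_den y).2.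

Lemma loc_mapE x s : loc_map (frac x s) = frac (u x) s.
Proof.
rewrite /loc_map; have := num_denK (frac x s); case: (num_den _) => x' s' /= /frac_eq[t St e].
apply/frac_eq; exists t; first exact: St.
have uZ a z : u (a *: z) = a *: u z by exact: linearZZ.
by rewrite -!uZ e.
Qed.

Lemma loc_map_linear : linear loc_map.
Proof.
elim/rlocP => a s; elim/locP => x t; elim/locP => y w.
rewrite fracZ fracD !loc_mapE fracZ fracD.
have uZ b z : u (b *: z) = b *: u z by exact: linearZZ.
by rewrite linearD !uZ.
Qed.
HB.instance Definition _ :=
  GRing.isLinear.Build (locring S) (loc S V) (loc S W) _ loc_map loc_map_linear.
End LocalizedMap.
Arguments loc_map {R} S {V W} u y.

(** * Restriction of scalars and localization of *injective resolutions *)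

Section GradedLocalization.
Variables (G : zmodType) (R : gradedRing G) (S : multSet R).
Hypothesis hS : ms_set S `<=` homog (@rcomp G R).
Local Notation RS := (gloc_ring hS).

Section RestrictScalars.
Variable B : gradedModule RS.

Definition ring_loc_map (a : R) : RS := rfrac a (den1 S).

Lemma ring_loc_map_comp g a : rcomp g a -> rcomp g (ring_loc_map a).
Proof.
by move=> ga; exists 0, a, (den1 S); split=> //; rewrite ?addr0 //; apply: rcomp1.
Qed.

(** An alias, so that the carrier of [B] can receive an [R]-module structure next to the one over
    [RS]. *)
Definition res_type : Type := B.
HB.instance Definition _ := GRing.Zmodule.on res_type.

Definition res_scale (a : R) (x : res_type) : res_type := ring_loc_map a *: (x : B).

Lemma res_scaleA a b x : res_scale a (res_scale b x) = res_scale (a * b) x.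
Proof.
rewrite /res_scale scalerA; congr (_ *: _).
by rewrite [LHS]rfracM; apply: rfrac_eq1; rewrite dvalM dval1 !mul1r.
Qed.
Lemma res_scale1 : left_id 1 res_scale.
Proof. by move=> x; rewrite /res_scale; exact: (scale1r (x : B)). Qed.
Lemma res_scaleDr : right_distributive res_scale +%R.
Proof. by move=> a x y; apply: scalerDr. Qed.
Lemma res_scaleDl x : {morph res_scale^~ x : a b / a + b}.
Proof.
move=> a b; rewrite /res_scale -scalerDl; congr (_ *: _).
rewrite [RHS]rfracD; apply: rfrac_eq1; by rewrite dvalM dval1 !mul1r.
Qed.
HB.instance Definition _ := GRing.Zmodule_isLmodule.Build R res_type
  res_scaleA res_scale1 res_scaleDr res_scaleDl.

Lemma res_compZ g h a (x : res_type) :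
  rcomp g a -> @mcomp _ _ B h x -> @mcomp _ _ B (g + h) (a *: x).
Proof. by move=> ga hx; apply: mcompZ => //; apply: ring_loc_map_comp. Qed.

Definition restrict_scalars : gradedModule R :=
  @GradedModule G R res_type (@mcomp _ _ B) (mcomp_grading B) res_compZ.
End RestrictScalars.

Lemma ring_loc_map_inv (s : den S) : rfrac 1 s * ring_loc_map (dval s) = 1 :> RS.
Proof. by rewrite [LHS]rfracM; apply: rfrac_eq1; rewrite !dvalM !dval1; ring. Qed.

Lemma rfracE a (s : den S) : rfrac a s = rfrac 1 s * ring_loc_map a :> RS.
Proof. by rewrite [RHS]rfracM; apply: rfrac_eq1; rewrite !dvalM !dval1; ring. Qed.

(** A map commuting with the action of [s] also commutes with that of its inverse [1/s], so
    [R]-linearity suffices. *)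
Lemma gloc_linear (A B : gradedModule RS) (f : A -> B) :
  zmod_morphism f -> (forall a x, f (ring_loc_map a *: x) = ring_loc_map a *: f x) -> linear f.
Proof.
move=> fB fZ; have fD x y : f (x + y) = f x + f y.
  have f0 : f 0 = 0 by rewrite -(subrr 0) fB subrr.
  by rewrite -{1}[y]opprK fB -[- y]sub0r fB f0 sub0r opprK.
move=> a x y; rewrite fD; congr (_ + _).
elim/rlocP: a => a s; have fs z : f (rfrac 1 s *: z) = rfrac 1 s *: f z :> B.
  rewrite -{2}[z](@scale1r RS) -(ring_loc_map_inv s) mulrC -scalerA fZ scalerA.
  by rewrite ring_loc_map_inv scale1r.
by rewrite rfracE -!scalerA fs fZ.
Qed.

Lemma loc_map_degree0 (A B : gradedModule R) (u : {linear A -> B}) :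
  degree0 u -> @degree0 _ _ (gloc_mod hS A) (gloc_mod hS B) (loc_map S u).
Proof.
move=> u0 g _ [h [x [s [sh gx ->]]]]; rewrite loc_mapE.
by exists h, (u x), s; split=> //; apply: u0.
Qed.

(** The section [sigma] carries the extension problem to [E] over [R]; the solution found there is
    pushed back to fractions, where [gloc_linear] makes it linear over [RS]. *)
Lemma gloc_injective (E : gradedModule R) (sigma : {linear restrict_scalars (gloc_mod hS E) -> E}) :
  star_injective E -> degree0 sigma -> (forall y, frac (sigma y) (den1 S) = y) ->
  star_injective (gloc_mod hS E).
Proof.
move=> hE s0 sK A B i u i0 iI u0.
have resL (X Y : gradedModule RS) (f : {linear X -> Y}) :
    linear (f : restrict_scalars X -> restrict_scalars Y).
  by move=> a x y; exact: (linearP f).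
pose ri : {linear restrict_scalars A -> restrict_scalars B} :=
  HB.pack (i : restrict_scalars A -> restrict_scalars B)
    (GRing.isLinear.Build _ _ _ _ _ (resL _ _ i)).
pose ru : {linear restrict_scalars A -> restrict_scalars (gloc_mod hS E)} :=
  HB.pack (u : restrict_scalars A -> restrict_scalars (gloc_mod hS E))
    (GRing.isLinear.Build _ _ _ _ _ (resL _ _ u)).
have [|||v v0 vE] := hE (restrict_scalars A) (restrict_scalars B) ri (sigma \o ru).
- exact: i0.
- exact: iI.
- by move=> g x gx; apply: s0; apply: u0.
pose w (b : B) : gloc_mod hS E := frac (v b) (den1 S).
have wL : linear w.
  apply: gloc_linear => [x y|a x]; rewrite /w.
    by rewrite -fracN -fracDl; congr frac; exact: (raddfB v).
  rewrite [RHS]fracZ; have -> : v (ring_loc_map a *: x) = a *: v x by exact: (linearZZ v).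
  by apply: frac_eq1; rewrite dvalM dval1 mul1r.
pose wl : {linear B -> gloc_mod hS E} := HB.pack w (GRing.isLinear.Build _ _ _ _ _ wL).
exists wl => [g b gb|x]; last by rewrite /= /w vE sK.
exists 0, (v b), (den1 S); split=> //; first exact: rcomp1.
by rewrite addr0; apply: v0.
Qed.

Section LocalizedComplex.
Variable C : complex R.

Lemma loc_cdiffK i x : loc_map S (cdiff C i.+1) (loc_map S (cdiff C i) x) = 0.
Proof. by elim/locP: x => x s; rewrite !loc_mapE cdiffK frac0. Qed.

Definition gloc_complex : complex RS :=
  @Complex _ RS (fun i => gloc_mod hS (C i)) (fun i => loc_map S (cdiff C i))
    (fun i => loc_map_degree0 (@cdiff0 _ _ C i)) loc_cdiffK.
End LocalizedComplex.

(** Exactness of localization: if [x/s] is a cocycle, some [u] in [S] makes [u *: x] a cocycle,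
    hence an image of some [m], and [m/(us)] maps to [x/s]. *)
Lemma gloc_resolution (M : gradedModule R) (C : complex R) (e : {linear M -> C 0}) :
  star_inj_resolution e -> (forall i, star_injective (gloc_mod hS (C i))) ->
  @star_inj_resolution _ RS (gloc_mod hS M) (gloc_complex C) (loc_map S e).
Proof.
move=> [e0 eI eK dK _] hC; split=> //.
- exact: loc_map_degree0.
- move=> x y /eqP; rewrite -subr_eq0 -linearB => /eqP xy; apply/eqP; rewrite -subr_eq0; apply/eqP.
  elim/locP: (x - y) xy => z s /=; rewrite loc_mapE => /frac_eq0[u Su].
  by rewrite -linearZZ -(linear0 e) => /eI uz; apply/frac_eq0; exists u.
- rewrite eqEsubset; split=> [_ [x _ <-]|]; rewrite /cocycle /mkset /=.
    elim/locP: x => x s; rewrite !loc_mapE.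
    suff -> : cdiff C 0 (e x) = 0 by rewrite frac0.
    by have : range e (e x) by [exists x]; rewrite eK.
  elim/locP => x s; rewrite loc_mapE => /frac_eq0[u Su]; rewrite -linearZZ => ux.
  have : @cocycle _ _ C 0 (u *: x) by [].
  rewrite -eK => -[m _ em]; exists (frac m (denM (den_of Su) s)) => //=.
  by rewrite loc_mapE em; apply: frac_eq1; rewrite dvalM scalerA mulrC.
- move=> i; rewrite eqEsubset; split=> [_ [x _ <-]|]; first exact: loc_cdiffK.
  rewrite /cocycle /mkset /=.
  elim/locP => x s; rewrite loc_mapE => /frac_eq0[u Su]; rewrite -linearZZ => ux.
  have : @cocycle _ _ C i.+1 (u *: x) by [].
  rewrite -dK => -[m _ em]; exists (frac m (denM (den_of Su) s)) => //=.
  by rewrite loc_mapE em; apply: frac_eq1; rewrite dvalM scalerA mulrC.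
Qed.
End GradedLocalization.

(** * The envelope of [R/q]: torsion, units and socle *)

Section Envelope.
Variables (G : zmodType) (R : gradedRing G).

Lemma gprime_sub (p : gprime R) (I : set R) :
  graded_sub (@rcomp G R) I -> (forall s, homog (@rcomp G R) s -> I s -> gp_set p s) -> I `<=` p.
Proof.
move=> gI H a /gI; apply: fin_sums_sub => [|s [Is hs]]; last exact: H.
exact: (is_submod_subgroup (gp_ideal p)).
Qed.

Variables (q : gprime R) (V : gradedModule R) (j : {linear gprime_quot q -> V}).
Hypothesis jE : star_envelope j.

(** The generator of the copy of [R/q] inside its envelope. *)
Definition env_gen : V := j (@qclass R R^o q (gp_ideal q) 1).

Lemma env_genZ a : a *: env_gen = j (@qclass R R^o q (gp_ideal q) a).
Proof.
rewrite /env_gen -linearZZ; congr (j _); rewrite -linearZZ; congr qclass.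
exact: mulr1.
Qed.

Lemma env_gen_eq0 a : a *: env_gen = 0 <-> gp_set q a.
Proof.
have [_ jI _ _] := jE; rewrite env_genZ; split=> [|qa].
  by rewrite -(linear0 j) => /jI /(qclass0 (gp_ideal q)).
by rewrite (_ : qclass _ _ = 0) ?linear0 //; apply/(qclass0 (gp_ideal q)).
Qed.

Lemma env_gen_comp : mcomp 0 env_gen.
Proof. by have [j0 _ _ _] := jE; apply: j0; exists 1 => //; apply: rcomp1. Qed.

Lemma env_rangeP (y : V) : range j y -> exists a, y = a *: env_gen.
Proof. by move=> [x _ <-]; exists (qrepr x); rewrite env_genZ qreprK. Qed.

Lemma env_range_homogP k (y : V) :
  mcomp k y -> range j y -> exists2 a, rcomp k a & y = a *: env_gen.
Proof.
have [j0 jI _ _] := jE => ky [x _ xy]; move: ky; rewrite -xy.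
move=> /(degree0_reflect j0 jI)[a ka <-]; exists a => //.
by rewrite env_genZ.
Qed.

Lemma env_essential g (y : V) : mcomp g y -> y <> 0 ->
  exists h b, [/\ rcomp h b, range j (b *: y) & b *: y <> 0].
Proof.
have [j0 _ _ ess] := jE; apply: essential_homog => //; first exact: range_submod.
exact: range_graded.
Qed.

(** The annihilators of [s ^+ n *: x] form an increasing chain; its union is finitely generated, and
    [N] is the largest exponent needed by the generators. *)
Lemma noetherian_ann_stable (s : R) (x : V) : noetherian R ->
  exists N, forall n a, a *: (s ^+ n *: x) = 0 -> a *: (s ^+ N *: x) = 0.
Proof.
move=> nR; pose I : set R := [set a | exists n, a *: (s ^+ n *: x) = 0].
have mono a m n : (m <= n)%N -> a *: (s ^+ m *: x) = 0 -> a *: (s ^+ n *: x) = 0.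
  move=> /subnKC <- e; rewrite exprD mulrC -scalerA scalerA mulrC -scalerA.
  by rewrite e scaler0.
have hI : is_ideal I.
  split=> [|a b c [m bm] [n cn]]; first by exists 0%N; rewrite scale0r.
  exists (maxn m n); rewrite scalerDl.
  have -> : (a *: (b : R^o) : R) = a * b by [].
  by rewrite -scalerA (mono b m) ?leq_maxl // (mono c n) ?leq_maxr // scaler0 addr0.
have [t It] := nR I hI.
have tI : forall c, c \in t -> I c.
  move=> c ct; rewrite It; apply: fin_sums_id; exists 1, c => //.
  by rewrite mul1r.
have [N HN] : exists N, forall c, c \in t -> c *: (s ^+ N *: x) = 0.
  elim: t {It} tI => [|c t IH] tI; first by exists 0%N.
  have [|N HN] := IH; first by move=> d dt; apply: tI; rewrite inE dt orbT.
  have [n cn] := tI c (mem_head _ _); exists (maxn N n) => d.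
  rewrite inE => /orP[/eqP ->|/HN dN]; first by apply: mono cn; rewrite leq_maxr.
  by apply: mono dN; rewrite leq_maxl.
exists N => n a an; have : I a by exists n.
rewrite It => -[u uI ->]; rewrite scaler_suml big1_seq // => w /andP[_ /uI[b [c ct ->]]].
by rewrite -scalerA HN ?scaler0.
Qed.

(** Take [y] homogeneous and [N] the stable exponent. If [s ^+ N *: y] were nonzero, some [b] would
    send it to a nonzero multiple of the generator. Since [s] kills the generator, [b] kills
    [s ^+ N.+1 *: y], hence [s ^+ N *: y] by stability. *)
Lemma env_torsion (s : R) (x : V) : noetherian R ->
  homog (@rcomp G R) s -> gp_set q s -> exists n, s ^+ n *: x = 0.
Proof.
move=> nR [h hs] qs.
have sX n : rcomp (h *+ n) (s ^+ n).
  elim: n => [|n IH]; first exact: rcomp1.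
  by rewrite exprS mulrS; apply: rcompM.
have key g (y : V) : mcomp g y -> exists n, s ^+ n *: y = 0.
  move=> gy; have [N HN] := noetherian_ann_stable s y nR; exists N.
  apply: contrapT => y0; have [k [b [kb Kb b0]]] := env_essential (mcompZ (sX N) gy) y0.
  apply: b0; apply: (HN N.+1); have [a ya] := env_rangeP Kb.
  rewrite exprS -scalerA scalerA mulrC -scalerA ya scalerA mulrC -scalerA.
  by rewrite (env_gen_eq0 s).2 ?scaler0.
have [t [f [_ ft _ ->]]] := mcompE x.
elim: t => [|g t [n IH]]; first by exists 0%N; rewrite big_nil scaler0.
have [m fm] := key g (f g) (ft g); exists (m + n)%N; rewrite big_cons scalerDr.
by rewrite {2}exprD addnC exprD -!scalerA IH fm !scaler0 addr0.
Qed.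

(** Multiplication by [s] is a degree 0 map into a shift of [V]. Its kernel meets [R/q] trivially,
    [q] being prime, so it is injective by essentiality. *Injectivity gives a left inverse, which is
    also a right inverse because it is linear and so commutes with [s]. *)
Lemma env_unit h (s : R) : rcomp h s -> ~ gp_set q s -> exists v : {linear V -> V},
  [/\ forall z, s *: v z = z, forall z, v (s *: z) = z
    & forall g z, mcomp (h + g) z -> mcomp g (v z)].
Proof.
have [_ _ Vinj ess] := jE => hs qs.
have muL : linear (fun z : V => s *: z).
  by move=> a x y; rewrite scalerDr !scalerA mulrC.
pose mu : {linear V -> shift V h} :=
  HB.pack (fun z : V => s *: z : shift V h) (GRing.isLinear.Build _ _ _ _ _ muL).
have mu0 : degree0 mu by move=> g x gx; exact: mcompZ.
have s0 (z : V) : s *: z = 0 -> z = 0.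
  suff H : [set z : V | mu z = 0] `<=` [set 0] by move=> sz; apply: H.
  apply: ess.
  - exact: ker_submod.
  - exact: ker_graded.
  - move=> y [ye /env_rangeP[a ya]]; have : s *: y = 0 by exact: ye.
    rewrite /mkset ya scalerA => /env_gen_eq0 qsa; apply/env_gen_eq0.
    by have [_ _ qM] := gp_prime q; have [] := qM _ _ qsa.
have muI : injective mu.
  move=> x y /eqP; rewrite -subr_eq0 -linearB => /eqP /s0 /eqP.
  by rewrite subr_eq0 => /eqP.
have [v v0 vE] := Vinj V (shift V h) mu idfun mu0 muI (fun _ _ => id).
have vL : linear (v : V -> V) by exact: linearP v.
pose w : {linear V -> V} := HB.pack (v : V -> V) (GRing.isLinear.Build _ _ _ _ _ vL).
exists w; split=> [z|z|g z gz]; [|exact: vE|exact: v0].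
by rewrite -linearZZ; exact: vE.
Qed.

(** Homogeneous elements outside [q] act injectively while [p] kills [z], so [p] lies in [q].
    Essentiality then gives a nonzero [b *: z = a *: env_gen]; neither [b] nor [a] is in [p], which
    kills both [z] and the generator. *)
Lemma env_socle (p : gprime R) g (z : V) :
  mcomp g z -> z <> 0 -> q `<=` p -> (forall a, gp_set p a -> a *: z = 0) ->
  gp_set q = gp_set p /\
  exists k b a, [/\ rcomp k b, ~ gp_set p b, rcomp (k + g) a, ~ gp_set p a & b *: z = a *: env_gen].
Proof.
move=> gz z0 qp pz.
have pq : p `<=` q.
  apply: gprime_sub => [|s [h hs] ps]; first exact: gp_graded.
  apply: contrapT => qs; apply: z0.
  by have [v [_ vK _]] := env_unit hs qs; rewrite -(vK z) pz ?linear0.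
split; first by rewrite eqEsubset.
have [k [b [kb Kb b0]]] := env_essential gz z0.
have [a ka e] := env_range_homogP (mcompZ kb gz) Kb.
exists k, b, a; split=> // [/pz //|/pq /env_gen_eq0 a0].
by apply: b0; rewrite e.
Qed.
End Envelope.

(** * Coordinates on a direct sum *)

Section DirectSumDecomposition.
Variables (G : zmodType) (R : gradedRing G).

Lemma dsum_coordinates (L : Type) (E : gradedModule R) (F : L -> gradedModule R)
    (theta : {linear E -> dsum F}) : gisom theta ->
  exists (c : forall l, {linear E -> F l}) (d : forall l, {linear F l -> E}),
    [/\ forall l, degree0 (c l) /\ degree0 (d l), forall l x, c l (d l x) = x,
        forall l k x, l <> k -> c l (d k x) = 0
      & forall x, exists s : seq {classic L}, x = \sum_(l <- s) d l (c l x)].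
Proof.
move=> [th0 [th' [th'0 thK th'K]]].
pose c0 l (x : E) : F l := submod_val (theta x) l.
have c0L l : linear (c0 l) by move=> a x y; rewrite /c0 linearP.
pose c l : {linear E -> F l} := HB.pack (c0 l) (GRing.isLinear.Build _ _ _ _ _ (c0L l)).
(* Equality of indices is decided classically, and [x] is transported because the summand depends on
   the index. *)
pose d0 l (x : F l) : dprod F :=
  fun k => if pselect (l = k) is left e then ecast k (F k) e x else 0.
have d0E l x : d0 l x l = x.
  by rewrite /d0; case: pselect => // e; rewrite (Prop_irrelevance e erefl).
have d0N l k x : l <> k -> d0 l x k = 0 by rewrite /d0; case: pselect.
have d0S l x : dsum_set (d0 l x).
  apply: (@sub_finite_set _ _ [set l]) => // k /=.
  by apply: contra_notP => kl; apply: d0N => e; apply: kl.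
pose d1 l x : dsum F := to_submod (dsum_submod F) (d0S l x).
have d1L l : linear (d1 l).
  move=> a x y; apply: submod_val_inj; rewrite [RHS]linearP.
  apply/functional_extensionality_dep => k.
  change (d0 l (a *: x + y) k = a *: d0 l x k + d0 l y k).
  have [e|lk] := pselect (l = k); first by case: _ / e; rewrite !d0E.
  by rewrite !d0N // scaler0 addr0.
pose d1l l : {linear F l -> dsum F} := HB.pack (d1 l) (GRing.isLinear.Build _ _ _ _ _ (d1L l)).
pose d l : {linear F l -> E} := th' \o d1l l.
exists c, d; split=> [l|l x|l k x lk|x].
- split=> g x gx; first by have [_] := th0 _ _ gx; apply.
  apply: th'0; split=> [|k]; first exact: d0S.
  change (mcomp g (d0 l x k)).
  have [e|lk] := pselect (l = k); first by case: _ / e; rewrite d0E.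
  by rewrite d0N //; exact: (subgroup0 (mcomp_subgroup _ _)).
- by rewrite /= /c0 th'K; exact: d0E.
- by rewrite /= /c0 th'K; apply: d0N => e; apply: lk.
- have /(@finite_seqP {classic L})[s sE] := submodP (theta x).
  (* The support of [theta x], without repetitions so that each coordinate counts once. *)
  exists (undup s).
  rewrite -linear_sum -[LHS]thK; congr (th' _).
  apply: submod_val_inj; rewrite raddf_sum; apply/functional_extensionality_dep => k.
  rewrite dprod_sumE.
  have [ks|ks] := boolP ((k : {classic L}) \in undup s).
    rewrite (bigD1_seq (k : {classic L})) ?undup_uniq //= d0E big1 ?addr0 // => l.
    by move=> /eqP lk; apply: d0N.
  rewrite big1_seq => [|l /andP[_ ls]]; last first.
    by apply: d0N => e; move: ks; rewrite -e ls.
  apply: contrapT => xk; have : [set l | submod_val (theta x) l <> 0] k by [].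
  by rewrite sE /= -mem_undup (negPf ks).
Qed.
End DirectSumDecomposition.

(** * Localizing a direct sum of shifted envelopes at [p], and its socle *)

Section LocalizedEnvelopes.
Variables (G : zmodType) (R : gradedRing G) (E : gradedModule R) (L : Type).
Variables (q : L -> gprime R) (n : L -> G) (EE : L -> gradedModule R).
Variable j : forall l, {linear gprime_quot (q l) -> EE l}.
Hypotheses (nR : noetherian R) (jE : forall l, star_envelope (j l)).
Variables (c : forall l, {linear E -> shift (EE l) (- n l)})
  (d : forall l, {linear shift (EE l) (- n l) -> E}).
Hypotheses (cd0 : forall l, degree0 (c l) /\ degree0 (d l))
  (cdK : forall l x, c l (d l x) = x) (cdN : forall l k x, l <> k -> c l (d k x) = 0)
  (cd_sum : forall x, exists s : seq {classic L}, x = \sum_(l <- s) d l (c l x)).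
Variable p : gprime R.
Local Notation S := (homog_compl_mult p).
Local Notation ES := (hloc_mod p E).
Local Notation toES := (fun x : E => frac x (den1 S) : ES).

Lemma frac_den1Z (x : E) a : toES (a *: x) = hloc_map p a *: toES x.
Proof. by rewrite [RHS]fracZ; apply: frac_eq1; rewrite dvalM dval1 mul1r. Qed.

(** A homogeneous element of [q l] outside [p] is inverted, yet one of its powers kills [x]. *)
Lemma coord_torsion l x s : ~ q l `<=` p -> frac (d l x) s = 0 :> ES.
Proof.
move=> qp; have [t [Ht qt pt]] : exists t, [/\ homog (@rcomp G R) t, gp_set (q l) t & ~ gp_set p t].
  apply: contrapT => H; apply: qp; apply: gprime_sub => [|t Ht qt]; first exact: gp_graded.
  by apply: contrapT => pt; apply: H; exists t.
have [k tk] := @env_torsion _ _ _ _ _ (jE l) t x nR Ht qt.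
apply/frac_eq0; exists (t ^+ k).
  elim: k {tk} => [|k IH]; first exact: ms1.
  by rewrite exprS; apply: (@msM _ S).
by rewrite -(linear0 (d l)) -tk linearZZ.
Qed.

(** For [y = x/s], the denominator lies outside every [q l] contained in [p], so those coordinates
    of [x] can be divided by [s] in the envelope; the others vanish after localization and are
    replaced by 0. *)
Lemma coord_section g (y : ES) : mcomp g y ->
  exists x, [/\ forall l, ~ q l `<=` p -> c l x = 0, mcomp g x & toES x = y].
Proof.
move=> [h [x [s [sh gx ->]]]]; have [t xE] := cd_sum x.
have key l : exists z : EE l, [/\ ~ q l `<=` p -> z = 0, mcomp (- n l + g) z
    & toES (d l z) = frac (d l (c l x)) s].
  have [qp|qp] := pselect (q l `<=` p); last first.
    exists 0; split=> //; first exact: (subgroup0 (mcomp_subgroup _ _)).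
    by rewrite !coord_torsion.
  have ps : ~ gp_set p (dval s) by have [] := denP s.
  have [v [vK _ vg]] := env_unit (jE l) sh (contra_not (@qp _) ps).
  exists (v (c l x)); split=> //.
    apply: vg; have : @mcomp _ _ (EE l) (- n l + (g + h)) (c l x) by exact: (cd0 l).1 _ _ gx.
    by rewrite (addrC g) addrCA.
  apply: frac_eq1; rewrite dval1 scale1r -linearZZ; congr (d l _).
  exact: vK.
pose z l := sval (cid (key l)).
have zP l : [/\ ~ q l `<=` p -> z l = 0, mcomp (- n l + g) (z l)
    & toES (d l (z l)) = frac (d l (c l x)) s] by exact: svalP (cid (key l)).
exists (\sum_(l <- t) d l (z l)); split=> [k kp||].
- rewrite linear_sum big1_seq // => l /andP[_ lt].
  have [lk|lk] := pselect (k = l); last exact: cdN.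
  by case: _ / lk; rewrite cdK; have [->] := zP k.
- apply: (subgroup_sum (mcomp_subgroup _ _)) => l _.
  by apply: (cd0 l).2; have [] := zP l.
- rewrite [in RHS]xE !frac_sum; apply: eq_bigr => l _.
  by have [] := zP l.
Qed.

(** An element of [S] killing [x] acts invertibly on each summand with [q l] inside [p], the only
    ones where [x] may have coordinates. *)
Lemma coord_section_inj x : (forall l, ~ q l `<=` p -> c l x = 0) -> toES x = 0 -> x = 0.
Proof.
move=> xp /frac_eq0[u [[h hu] pu] ux]; have [t ->] := cd_sum x.
rewrite big1_seq // => l _; have [qp|/xp ->] := pselect (q l `<=` p); last exact: linear0.
have [v [_ vK _]] := env_unit (jE l) hu (contra_not (@qp _) pu).
have : u *: (c l x : EE l) = 0 by have := linearZZ (c l) u x; rewrite ux linear0.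
move=> e; suff -> : c l x = 0 by rewrite linear0.
by rewrite -[LHS]vK e linear0.
Qed.

Lemma loc_section : exists sigma : {linear restrict_scalars ES -> E},
  [/\ degree0 sigma, forall y, toES (sigma y) = y
    & forall y l, ~ q l `<=` p -> c l (sigma y) = 0].
Proof.
pose Q x := forall l, ~ q l `<=` p -> c l x = 0.
have toESP a x y : toES (a *: x + y) = hloc_map p a *: toES x + toES y.
  by rewrite -frac_den1Z -fracDl.
have ex y : exists x, Q x /\ toES x = y.
  have [t [f [_ ft _ ->]]] := @mcompE _ _ ES y.
  elim: t => [|g t [x [Qx xE]]].
    by exists 0; rewrite big_nil; split; [move=> l _; rewrite linear0|rewrite frac0].
  have [z [Qz _ zE]] := coord_section (ft g); exists (z + x); rewrite big_cons; split.
    by move=> l lp; rewrite linearD Qz // Qx // addr0.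
  by rewrite fracDl zE xE.
pose f y := sval (cid (ex y)).
have fP y : Q (f y) /\ toES (f y) = y by exact: svalP (cid (ex y)).
(* Uniqueness of the lift makes the choice [f] linear and degree-preserving. *)
have fU x y : Q x -> toES x = y -> f y = x.
  move=> Qx xy; have [Qf fy] := fP y; apply/eqP; rewrite -subr_eq0; apply/eqP.
  apply: coord_section_inj => [l lp|]; first by rewrite linearB Qx // Qf // subr0.
  by rewrite fracDl fracN fy xy subrr.
have fL : linear (f : restrict_scalars ES -> E).
  move=> a x y; apply: fU => [l lp|]; last by rewrite toESP !(fP _).2.
  by rewrite linearP !(fP _).1 // scaler0 addr0.
pose sigma : {linear restrict_scalars ES -> E} :=
  HB.pack (f : restrict_scalars ES -> E) (GRing.isLinear.Build _ _ _ _ _ fL).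
exists sigma; split=> [g y gy|y|y].
- by have [x [Qx gx xy]] := coord_section gy; rewrite /sigma /= (fU _ _ Qx xy).
- by have [] := fP y.
- by have [] := fP y.
Qed.

Lemma hloc_injective : star_injective E -> star_injective ES.
Proof.
by move=> hE; have [sigma [s0 sK _]] := loc_section; apply: (gloc_injective hE s0 sK).
Qed.

(** If [sigma z] is nonzero, essentiality gives [b] with [b *: sigma z] nonzero and in the kernel of
    [f]. Such a [b] is not in [p], which kills [z]; so it is inverted, and [f] localized kills
    [z]. *)
Lemma hloc_socle_ker (E' : gradedModule R) (f : {linear E -> E'}) g (z : ES) :
  degree0 f -> star_essential [set x | f x = 0] -> mcomp g z ->
  (forall a, gp_set p a -> hloc_map p a *: z = 0) -> loc_map S f z = 0.
Proof.
move=> f0 ess gz pz; have [sigma [s0 sK _]] := loc_section.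
have [z0|z0] := pselect (sigma z = 0).
  by rewrite -(sK z) z0 frac0 linear0.
have [h [b [hb fb b0]]] :=
  essential_homog (ker_submod f) (ker_graded f0) ess (s0 _ _ gz) z0.
rewrite -(sK z) loc_mapE; apply/frac_eq0; exists b; last by rewrite -linearZZ.
split; first by exists h.
move=> /pz bz; apply: b0.
have -> : b *: sigma z = sigma (hloc_map p b *: z) by rewrite -linearZZ.
by rewrite bz linear0.
Qed.

(* Those with q l = p form a basis, over the residue ring, of the elements of E_(p) killed by p. *)
Definition socle_gen l : ES := toES (d l (env_gen (j l))).

Lemma socle_gen_comp l : mcomp (n l) (socle_gen l).
Proof.
exists 0, (d l (env_gen (j l))), (den1 S); split=> //; first exact: rcomp1.
rewrite addr0; apply: (cd0 l).2.
by rewrite /mcomp /= addNr; exact: env_gen_comp.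
Qed.

Lemma socle_gen_ann l a : gp_set (q l) = gp_set p -> hloc_ideal (p := p) a -> a *: socle_gen l = 0.
Proof.
move=> qp [t tp ->]; rewrite scaler_suml big1_seq // => _ /andP[_ /tp[b [_ [x px <-] ->]]].
rewrite -scalerA -frac_den1Z -linearZZ.
by rewrite ((env_gen_eq0 (jE l) x).2 _) ?qp // linear0 frac0 scaler0.
Qed.

(** Each nonzero coordinate of [sigma z] has [q l] inside [p] and is killed by [p], so by
    [env_socle] it is [a/b] times the generator. The degrees of [b] and [a] are recorded to locate
    [n l] later. *)
Lemma socle_gen_expand g (z : ES) : mcomp g z ->
  (forall a, gp_set p a -> hloc_map p a *: z = 0) ->
  exists (s : seq {classic L}) (a : {classic L} -> hloc_ring p),
    z = \sum_(l <- s) a l *: socle_gen l /\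
    forall l, l \in s -> gp_set (q l) = gp_set p /\
      exists k b a, [/\ rcomp k b, ~ gp_set p b, rcomp (k + (- n l + g)) a & ~ gp_set p a].
Proof.
move=> gz pz; have [sigma [s0 sK sp]] := loc_section.
have [t tE] := cd_sum (sigma z).
have pc l a : gp_set p a -> a *: c l (sigma z) = 0.
  move=> pa; rewrite -linearZZ -[a *: _]linearZZ.
  have -> : a *: (z : restrict_scalars ES) = hloc_map p a *: z by [].
  by rewrite pz // !linear0.
pose s : seq {classic L} := [seq l <- t | c l (sigma z) != 0].
have sE : sigma z = \sum_(l <- s) d l (c l (sigma z)).
  rewrite big_filter big_mkcond [LHS]tE; apply: eq_bigr => l _.
  by case: eqP => // ->; rewrite linear0.
have key (l : {classic L}) : l \in s -> gp_set (q l) = gp_set p /\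
    exists k b a, [/\ rcomp k b, ~ gp_set p b, rcomp (k + (- n l + g)) a, ~ gp_set p a
      & b *: (c l (sigma z) : EE l) = a *: env_gen (j l)].
  rewrite mem_filter => /andP[/eqP cl _]; apply: (env_socle (jE l)) => //.
  - exact: ((cd0 l).1 _ _ (s0 _ _ gz)).
  - by apply: contrapT => lp; apply: cl; apply: sp.
  - exact: pc.
have coef (l : {classic L}) : exists a : hloc_ring p,
    l \in s -> toES (d l (c l (sigma z))) = a *: socle_gen l.
  have [/key[_ [k [b [a [kb pb _ _ e]]]]]|ls] := boolP (l \in s); last by exists 0.
  have Sb : ms_set S b by split=> //; exists k.
  exists (rfrac a (den_of Sb)) => _; rewrite /socle_gen fracZ.
  apply: frac_eq1; rewrite dvalM dval1 mulr1 scale1r -[LHS]linearZZ -[RHS]linearZZ; congr (d l _).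
  exact: e.
have [a aE] := choice coef; exists s, a; split=> [|l /key[qp [k [b [x [? ? ? ? _]]]]]].
  rewrite -[LHS]sK {1}sE frac_sum; apply: eq_big_seq => l; exact: aE.
by split=> //; exists k, b, x.
Qed.

(** The localized projection to coordinate [l] isolates one term; there the numerator of [a l],
    times an element outside [p], annihilates the generator, so it lies in [p]. *)
Lemma socle_gen_indep (s : seq {classic L}) (a : {classic L} -> hloc_ring p) :
  uniq s -> (forall l, l \in s -> gp_set (q l) = gp_set p) ->
  \sum_(l <- s) a l *: socle_gen l = 0 -> forall l, l \in s -> hloc_ideal (p := p) (a l).
Proof.
move=> us qp e l ls.
pose F k : loc S (shift (EE l) (- n l)) := frac (c l (d k (env_gen (j k)))) (den1 S).
have : \sum_(k <- s) a k *: F k = 0.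
  rewrite -[RHS](linear0 (loc_map S (c l))) -e linear_sum; apply: eq_bigr => k _.
  by rewrite /F -loc_mapE; apply/esym; exact: linearZZ.
rewrite (bigD1_seq l) //= big1 ?addr0 => [|k /eqP kl]; last first.
  by rewrite /F cdN ?frac0 ?scaler0 // => lk; apply: kl.
rewrite /F cdK; elim/rlocP: (a l) => b t.
rewrite fracZ => /frac_eq0[u [_ pu]].
rewrite scalerA => /(env_gen_eq0 (jE l)); rewrite qp // => pub.
have [_ _ pM] := gp_prime p; have [//|pb] := pM _ _ pub.
apply: fin_sums_id; exists (rfrac 1 t), (hloc_map p b); first by exists b.
exact: (rfracE (homog_compl_homog (p := p))).
Qed.

Lemma socle_gen_inj l k : gp_set (q l) = gp_set p -> socle_gen l = socle_gen k -> l = k.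
Proof.
move=> qp e; apply: contrapT => lk.
have := congr1 (loc_map S (c l)) e; rewrite !loc_mapE cdK cdN // frac0 => /frac_eq0[u [_ pu]].
by move=> /(env_gen_eq0 (jE l)); rewrite qp.
Qed.
End LocalizedEnvelopes.

(** * Homomorphisms from [R/I], identified with elements killed by [I] through their value at 1 *)

Section QuotientHom.
Variables (G : zmodType) (R : gradedRing G) (I : set R) (hI : is_ideal I).
Variables (gI : graded_sub (@rcomp G R) I) (X : gradedModule R).
Local Notation A := (quot_gmod hI gI).
Local Notation one := (@qclass R R^o I hI 1).

Lemma quot_hom_val (f : star_hom A X) (a : R) :
  submod_val f (@qclass R R^o I hI a) = a *: submod_val f one.
Proof.
have fL := star_hom_linear f; have := fL a one 0.
have -> : submod_val f 0 = 0.
  by have := fL (-1) 0 0; rewrite scaler0 add0r scaleN1r addNr.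
rewrite !addr0 => <-; congr (submod_val f _).
by rewrite -linearZZ; congr qclass; rewrite [RHS]mulr1.
Qed.

Lemma quot_hom_ann (f : star_hom A X) (a : R) : I a -> a *: submod_val f one = 0.
Proof.
move=> Ia; rewrite -quot_hom_val (_ : @qclass R R^o I hI a = 0); last exact/(qclass0 hI).
by have := star_hom_linear f (-1) 0 0; rewrite scaler0 add0r scaleN1r addNr.
Qed.

Lemma quot_hom_inj (f : star_hom A X) : submod_val f one = 0 -> f = 0.
Proof.
move=> f1; apply: submod_val_inj; rewrite [RHS]raddf0; apply/funext => x.
by rewrite -(qreprK x) quot_hom_val f1 scaler0.
Qed.

Lemma quot_hom_exists g (x : X) : mcomp g x -> (forall a, I a -> a *: x = 0) ->
  exists f : star_hom A X, mcomp g f /\ submod_val f one = x.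
Proof.
move=> gx Ix; have uL : linear (fun a : R^o => a *: x).
  by move=> a b c; rewrite scalerDl -scalerA.
pose u : {linear R^o -> X} := HB.pack (fun a : R^o => a *: x) (GRing.isLinear.Build _ _ _ _ _ uL).
have [v vE] := @quotmod_lift G R R^o X I hI u Ix.
have vg : hom_deg g (v : A -> X).
  split=> [a y z|h _ [a ha <-]]; first exact: linearP.
  by rewrite vE /=; exact: (mcompZ ha gx).
have vS : star_hom_set (v : A -> X) by apply: fin_sums_id; exists g.
exists (to_submod (star_hom_submod A X) vS); split; first exact: vg.
by rewrite /= vE /= scale1r.
Qed.
End QuotientHom.

(** In [is_basis] the coefficients are a function of the vector, so the terms carrying the same
    vector have to be merged. *)
Lemma fin_sums_combination (T : comPzRingType) (V : lmodType T) (B : set V) w :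
  fin_sums [set u | exists2 v, B v & exists a, u = a *: v] w ->
  exists (s : seq V) (c : V -> T), (forall v, v \in s -> B v) /\ w = \sum_(v <- s) c v *: v.
Proof.
move=> [t tB ->].
have /choice[b bE] u : exists x : V * T, u \in t -> B x.1 /\ u = x.2 *: x.1.
  have [/tB[v Bv [a ->]]|_] := boolP (u \in t); first by exists (v, a).
  by exists (0, 0).
exists (undup [seq (b u).1 | u <- t]), (fun v => \sum_(u <- t | (b u).1 == v) (b u).2); split.
  by move=> v; rewrite mem_undup => /mapP[u /bE[Bu _] ->].
under [RHS]eq_bigr => v _ do rewrite scaler_suml big_mkcond.
rewrite exchange_big; apply: eq_big_seq => u ut.
have [_ uE] := bE u ut; have bu : (b u).1 \in undup [seq (b u).1 | u <- t].
  by rewrite mem_undup; apply/mapP; exists u.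
rewrite (bigD1_seq _ bu (undup_uniq _)) eqxx -uE big1 /= ?addr0 //.
by move=> v; rewrite eq_sym => /negPf ->.
Qed.

(** * Degrees occurring outside [p] when [R] is standard *)

Section Multigraded.
Variables (r : nat) (R : gradedRing 'rV[int]_r).
Hypothesis sR : standard R.
Variable p : gprime R.

(** For [k] in [dir p], the elements congruent modulo [p] to a sum of homogeneous elements with
    [k]-th degree 0 form a subring containing all the generators of [R], since [p] contains those of
    degree [e_k]. So [x] is such an element, and comparing degrees in [R/p] forces the [k]-th degree
    of [x] to be 0. *)
Lemma dir_proj_eq0 n x : rcomp n x -> ~ gp_set p x -> dir_proj p n = 0.
Proof.
move=> nx px; apply/rowP => k0; rewrite !mxE.
set k := enum_val k0; have : k \in dir p by exact: enum_valP.
rewrite inE => /asboolP kp; apply: contrapT => nk.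
pose C (g : 'rV[int]_r) : set R := if g 0 k == 0 then rcomp g else [set 0].
have sC g : subgroup (C g).
  rewrite /C; case: ifP => _; first exact: (mcomp_subgroup (regular_gmod R)).
  by split=> // x' y' /= -> ->; rewrite subr0.
have CN v : homog C v -> homog C (- v) by exact: homogN.
have sA := fin_sums_subgroup CN.
have sp := is_submod_subgroup (gp_ideal p).
have pZ a b : gp_set p b -> gp_set p (a * b).
  by move=> pb; apply: (@is_submodZ R R^o); first exact: gp_ideal.
pose K : set R := [set z | exists2 a, fin_sums (homog C) a & gp_set p (z - a)].
have AM a b : fin_sums (homog C) a -> fin_sums (homog C) b -> fin_sums (homog C) (a * b).
  move=> [s sH ->] [t tH ->]; rewrite mulr_suml; apply: subgroup_sum => // u /sH[g gu].
  rewrite mulr_sumr; apply: subgroup_sum => // v /tH[h hv].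
  apply: fin_sums_id; exists (g + h); move: gu hv; rewrite {1 2}/C.
  case: eqP => [gk gu|_ /= -> _]; last by rewrite mul0r; exact: subgroup0.
  case: eqP => [hk hv|_ /= ->]; last by rewrite mulr0; exact: subgroup0.
  by rewrite /C mxE gk hk addr0 eqxx; apply: rcompM.
have CK (g : 'rV[int]_r) (z : R) : g 0 k = 0 -> rcomp g z -> K z.
  move=> gk gz; exists z; last by rewrite subrr; apply: subgroup0.
  by apply: fin_sums_id; exists g; rewrite /C gk eqxx.
have KT : K = setT.
  apply: sR => [|z z0|m z mz].
  - split; first by apply: (CK 0); rewrite ?mxE //; apply: rcomp1.
      move=> a b [a' Aa' pa] [b' Ab' pb]; exists (a' - b'); first exact: subgroupB.
      have -> : a - b - (a' - b') = (a - a') - (b - b') by ring.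
      exact: subgroupB.
    move=> a b [a' Aa' pa] [b' Ab' pb]; exists (a' * b'); first exact: AM.
    have -> : a * b - a' * b' = b * (a - a') + a' * (b - b') by ring.
    by apply: subgroupD => //; apply: pZ.
  - by apply: (CK 0); rewrite ?mxE.
  - have [mk|mk] := eqVneq m k; last by apply: CK mz; rewrite mxE eqxx eq_sym (negPf mk).
    exists 0; first exact: subgroup0.
    by rewrite subr0; apply: kp; rewrite -mk.
have [a Aa pxa] : K x by rewrite KT.
have [||s [f [us fC f0 aE]]] := @fin_sums_homogE _ _ C setT a sC.
- by split.
- by apply: fin_sums_incl Aa => v Cv; split.
apply: px; apply/(@qclass0 R R^o p (gp_ideal p)).
have xE : @qclass R R^o p (gp_ideal p) x = \sum_(g <- s) @qclass R R^o p (gp_ideal p) (f g).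
  by rewrite -linear_sum -aE; apply/(@qclass_eq R R^o p (gp_ideal p)).
have fq g : @mcomp _ _ (gprime_quot p) g (@qclass R R^o p (gp_ideal p) (f g)).
  exists (f g) => //; have [_] := fC g; rewrite /C; case: ifP => // _ /= ->.
  exact: (subgroup0 (mcomp_subgroup (regular_gmod R) _)).
have nq : @mcomp _ _ (gprime_quot p) n (@qclass R R^o p (gp_ideal p) x) by exists x.
rewrite xE big1_seq // => g /andP[_ gs].
have [gn|gn] := eqVneq g n; last exact: (homog_component nq us fq xE gs gn).
by have [_] := fC g; rewrite gn /C (negPf (introN eqP nk)) => /= ->; rewrite linear0.
Qed.

(** A nonzero homogeneous element of [T] is the class of [x/u] with [x] and [u] homogeneous outside
    [p]; both degrees project to 0. *)
Lemma coarsen_residue_ring : coarsen (dir_proj p) (@rcomp _ (residue_ring p)) 0 = setT.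
Proof.
apply/seteqP; split=> // t _; have [_ /(_ t I) + _] := rcomp_grading (residue_ring p).
move=> tH; have [s [f [_ fR _ ->]]] := grading_homogE (rcomp_grading (residue_ring p)) (I : setT t).
have sW : subgroup (coarsen (dir_proj p) (@rcomp _ (residue_ring p)) 0).
  apply: fin_sums_subgroup => v [g g0 gv]; exists g => //.
  by apply: (subgroupN (mcomp_subgroup (regular_gmod (residue_ring p)) g)).
apply: subgroup_sum => // g _.
have [-> |fg] := pselect (f g = 0); first exact: subgroup0.
apply: fin_sums_id; exists g => //.
have [b [h [x [u [hu gx bE]]]] be] := fR g.
have px : ~ gp_set p x.
  move=> px; apply: fg; rewrite -be; apply/(@qclass0 _ _ _ (hloc_ideal_ideal p)).
  rewrite bE; apply: fin_sums_id; exists (rfrac 1 u), (hloc_map p x); first by exists x.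
  exact: (rfracE (homog_compl_homog (p := p))).
have := dir_proj_eq0 gx px; rewrite raddfD /= (dir_proj_eq0 hu) ?addr0 //.
by have [] := denP u.
Qed.

End Multigraded.

(** * The rank of the components of *Ext *)

Theorem theorem2p7
  (r : nat) (r_gt0 : (0 < r)%N)
  (R : gradedRing 'rV[int]_r)
  (R_noetherian : noetherian R)
  (R_positive : positively_graded R)
  (R_standard : standard R)
  (M : gradedModule R)
  (E : complex R) (eps : {linear M -> E 0%N})
  (E_minimal : minimal_star_inj_resolution eps)
  (Lam : nat -> Type)
  (q : forall i, Lam i -> gprime R)
  (n : forall i, Lam i -> 'rV[int]_r)
  (EE : forall i, Lam i -> gradedModule R)
  (j : forall i (l : Lam i), {linear gprime_quot (q i l) -> EE i l})
  (EE_envelope : forall i (l : Lam i), star_envelope (j i l))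
  (theta : forall i, {linear E i -> dsum (fun l : Lam i => shift (EE i l) (- n i l))})
  (theta_iso : forall i, gisom (theta i))
  (p : gprime R)
  (p_Var : ideal_gen (@rcomp _ R (const_mx 1)) `<=` gp_set p)
  (i : nat) (a : 'rV[int]_#|dir p|) :
  has_rank
    (coarsen (dir_proj p) (@rcomp _ (residue_ring p)) 0)
    (coarsen (dir_proj p) (@mcomp _ _ (residue_ext p M i)) a)
    [set l : Lam i | gp_set (q i l) = gp_set p /\ dir_proj p (n i l) = a].
Proof.
have [hres ess] := E_minimal.
have Einj k : star_injective (hloc_mod p (E k)).
  have [c [d [cd0 cdK cdN cd_sum]]] := dsum_coordinates (theta_iso k).
  have [_ _ _ _ Ek] := hres.
  exact: (hloc_injective R_noetherian (EE_envelope k) cd0 cdK cdN cd_sum (Ek k)).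
have Sres := gloc_resolution (hS := @homog_compl_homog _ R p) hres Einj.
(* Both [f] and [x] are split into homogeneous parts: the value of a part is then homogeneous and
   killed by [p], as [hloc_socle_ker] requires. *)
have dA k (f : star_hom (residue_mod p) (hloc_mod p (E k))) x :
    loc_map (homog_compl_mult p) (cdiff E k) (submod_val f x) = 0.
  have [c [d [cd0 cdK cdN cd_sum]]] := dsum_coordinates (theta_iso k).
  have [t tH ->] := submodP f; rewrite fct_sumE linear_sum big1_seq // => v /andP[_ /tH[g [vL vg]]].
  pose vl : {linear residue_mod p -> hloc_mod p (E k)} :=
    HB.pack v (GRing.isLinear.Build _ _ _ _ _ vL).
  have [s [y [_ ys _ ->]]] := mcompE x.
  change (loc_map (homog_compl_mult p) (cdiff E k) (vl (\sum_(g <- s) y g)) = 0).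
  rewrite !linear_sum big1_seq // => h _.
  apply: (hloc_socle_ker R_noetherian (EE_envelope k) cd0 cdK cdN cd_sum (@cdiff0 _ _ E k) (ess k)
            (vg _ _ (ys h))) => b pb.
  change (hloc_map p b *: vl (y h) = 0); rewrite -linearZZ.
  suff -> : hloc_map p b *: y h = 0 by rewrite linear0.
  rewrite -(qreprK (y h)) -linearZZ; apply/(@qclass0 _ _ _ (hloc_ideal_ideal p)).
  apply: fin_sums_id; exists (qrepr (y h)), (hloc_map p b); first by exists b.
  exact: mulrC.
have [psi [psi0 psiI psiS]] : exists psi : {linear star_hom (residue_mod p) (hloc_mod p (E i)) ->
      star_ext (hloc_mod p M) (residue_mod p) i},
    [/\ degree0 psi, forall f, psi f = 0 -> f = 0
      & forall g w, mcomp g w -> exists2 f, mcomp g f & psi f = w].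
  exact: star_ext_trivial_diff Sres dA.
have [c [d [cd0 cdK cdN cd_sum]]] := dsum_coordinates (theta_iso i).
pose x l := socle_gen (j i) d p l.
pose one := @qclass _ _ _ (hloc_ideal_ideal p) 1.
(* [h l] sends 1 to the socle generator of index [l]; 0 is a dummy for the other primes. *)
have /choice[h hP] l : exists f : star_hom (residue_mod p) (hloc_mod p (E i)),
    gp_set (q i l) = gp_set p -> mcomp (n i l) f /\ submod_val f one = x l.
  have [qp|qp] := pselect (gp_set (q i l) = gp_set p); last by exists 0.
  have [b Ib|f fP] := quot_hom_exists (hloc_ideal_ideal p) (@hloc_ideal_graded _ _ p)
    (socle_gen_comp (EE_envelope i) cd0 p l); last by exists f.
  exact: socle_gen_ann.
pose ev (f : star_hom (residue_mod p) (hloc_mod p (E i))) := submod_val f one.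
have evh l : gp_set (q i l) = gp_set p -> ev (h l) = x l by move=> /hP[].
have ev_sum (I : eqType) (s : seq I) (b : I -> hloc_ring p) F :
    ev (\sum_(k <- s) b k *: F k) = \sum_(k <- s) b k *: ev (F k).
  rewrite /ev raddf_sum fct_sumE; apply: eq_bigr => k _.
  exact: (congr1 (fun g => g one) (linearZZ (@submod_val _ _ _ _) (b k) (F k))).
have tE (b : hloc_ring p) (v : star_ext (hloc_mod p M) (residue_mod p) i) :
    rclass (hloc_ideal_ideal p) b *: (v : residue_ext p M i) = b *: v.
  exact: annscaleE.
pose b l : residue_ext p M i := psi (h l).
pose A := [set l : Lam i | gp_set (q i l) = gp_set p /\ dir_proj p (n i l) = a].
have bI : {in A &, injective b}.
  move=> l k /set_mem[lp _] /set_mem[kp _] /eqP; rewrite -subr_eq0.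
  have -> : b l - b k = psi (h l - h k) by rewrite linearB.
  move=> /eqP/psiI/eqP; rewrite subr_eq0 => /eqP e.
  apply: (socle_gen_inj (EE_envelope i) cdK cdN lp).
  by rewrite -[LHS](evh l lp) -[RHS](evh k kp) e.
exists (b @` A); last exact: inj_card_eq.
(* All of [T] is in degree 0, so any coefficient in [T] is admissible. *)
rewrite coarsen_residue_ring //; split.
- move=> _ [l [lp la] <-]; apply: fin_sums_id; exists (n i l) => //.
  by apply: psi0; have [] := hP l lp.
(* Spanning: each homogeneous part of [w] is some [psi f], and the expansion of [ev f] in socle
   generators lifts to one of [f], as [f] is determined by its value at 1. *)
- move=> w wa; suff /fin_sums_combination[s [e [sB ->]]] :
    fin_sums [set u | exists2 v, (b @` A) v & exists e, u = e *: v] w by exists s, e.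
  apply: fin_sums_sub wa.
    by apply: fin_sums_subgroup => _ [v Bv [e ->]]; exists v => //; exists (- e); rewrite scaleNr.
  move=> u [g ga gu]; have [f gf <-] := psiS g u gu.
  have gz : mcomp g (ev f).
    have [_ fg] := gf; rewrite -[g]add0r; apply: fg; exists 1 => //.
    exact: (rcomp1 (hloc_ring p)).
  have pz k : gp_set p k -> hloc_map p k *: ev f = 0.
    move=> pk; apply: quot_hom_ann; apply: fin_sums_id.
    by exists 1, (hloc_map p k); [exists k|rewrite mul1r].
  have [s [e [zE sP]]] := socle_gen_expand R_noetherian (EE_envelope i) cd0 cdK cdN cd_sum gz pz.
  have -> : f = \sum_(l <- s) e l *: h l.
    apply/eqP; rewrite -subr_eq0; apply/eqP; apply: quot_hom_inj.
    rewrite raddfB; apply/eqP; rewrite subr_eq0; apply/eqP.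
    rewrite [LHS]zE [RHS]ev_sum; apply: eq_big_seq => l /sP[lp _].
    by rewrite evh.
  rewrite linear_sum; apply: subgroup_sum => [|l ls].
    by apply: fin_sums_subgroup => _ [v Bv [k ->]]; exists v => //; exists (- k); rewrite scaleNr.
  apply: fin_sums_id; exists (b l).
    (* The degrees [k] and [k + (- n l + g)] of two elements outside [p] project to 0, so [n l] and
       [g] have the same projection [a]. *)
    have [lp [k [t [y [kt pt ky py]]]]] := sP l ls; exists l => //; split=> //.
    have := dir_proj_eq0 R_standard ky py.
    rewrite !raddfD raddfN /= (dir_proj_eq0 R_standard kt pt) add0r ga => /eqP.
    by rewrite addrC subr_eq0 => /eqP.
  by exists (rclass (hloc_ideal_ideal p) (e l)); rewrite tE linearZZ.
- move=> s e us sB _ e0 v0 v0s; have [l0 _ _] := sB v0 v0s.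
  (* The index [l0], at hand because [v0] is in [s], is the default value off [s]. *)
  have /choice[l lP] v : exists l, v \in s -> A l /\ b l = v.
    have [/sB[l lA lv]|_] := boolP (v \in s); first by exists l.
    by exists l0.
  pose t : seq {classic Lam i} := map l s.
  have ut : uniq t.
    rewrite map_inj_in_uniq // => u v /lP[_ ub] /lP[_ vb] uv.
    by rewrite -ub -vb uv.
  (* The coefficients are lifted to [R_(p)], where independence will place them in the ideal
     [pR_(p)]. *)
  pose y (k : {classic Lam i}) : hloc_ring p := rrepr (e (b k)).
  have yE : \sum_(k <- t) y k *: x k = 0.
    have /psiI : psi (\sum_(k <- t) y k *: h k) = 0.
      rewrite -[RHS]e0 linear_sum big_map; apply: eq_big_seq => v /lP[_ vb].
      by rewrite linearZZ -tE rreprK -/(b _) vb.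
    move=> /(congr1 ev); rewrite ev_sum => yE.
    rewrite -[RHS]yE; apply: eq_big_seq => k /mapP[v /lP[[kp _] _] kE].
    by rewrite evh // kE.
  have := socle_gen_indep (EE_envelope i) cdK cdN ut _ yE.
  move=> /(_ _ (l v0)) H; rewrite -[e v0]rreprK.
  apply/(@qclass0 _ _ _ (hloc_ideal_ideal p)).
  have [_ <-] := lP v0 v0s; apply: H; last by apply: map_f.
  by move=> k /mapP[v /lP[[kp _] _] ->].
Qed.
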